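(* Let $F=\mathbb{R}$. Then the following is the list of $4$-dimensional nilpotent associative algebras over $F$ up to isomorphism (every such algebra is isomorphic to exactly one of them): $A_{4,1}$, $A_{4,2}$, $A_{4,3}^\delta$ ($\delta=\pm1$), $A_{4,4}^\delta$ ($\delta\in F$), $A_{4,5}$, $A_{4,6}$, $A_{4,7}$, $A_{4,8}^{1,\beta}$ ($\beta=\pm1$), $A_{4,9}^{1,\beta}$ ($\beta\in F$), $A_{4,9}^{-1,\beta}$ ($\beta\in F$, $\beta\geq\frac14$), $A_{4,10}^0$, $A_{4,11}$, $A_{4,12}$, $A_{4,13}$, $A_{4,14}$, $A_{4,15}$, $A_{4,16}$, $A_{4,18}^\delta$ ($\delta=0,\pm1$), $A_{4,20}$, $A_{4,21}^\delta$ ($\delta\in F$, $\delta\neq-1$), $A_{4,23}^\delta$ ($\delta=\pm1$), $A_{4,24}$, $A_{4,25}^{\alpha,0,\gamma}$ ($\alpha\in(-1,1)$, $\gamma=\pm1$), $A_{4,25}^{\alpha,\sqrt2(1-\alpha),-1}$ ($\alpha\in(-1,1)$).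
   Context: Algebras are associative algebras over $F$, not assumed unital; an algebra is nilpotent if all products of $n$ elements vanish for some $n$. Notation: $\langle a,b,c,d\mid\text{relations}\rangle$ denotes the algebra with vector space basis $a,b,c,d$ whose multiplication is determined by the listed products of basis elements, all other products of basis elements being zero. The algebras are: $A_{4,1}=\langle a,b,c,d\mid\ \rangle$; $A_{4,2}=\langle a,b,c,d\mid a^2=b\rangle$; $A_{4,3}^\delta=\langle a,b,c,d\mid a^2=c, b^2=\delta c\rangle$; $A_{4,4}^\delta=\langle a,b,c,d\mid a^2=c, b^2=\delta c, ab=c\rangle$; $A_{4,5}=\langle a,b,c,d\mid ab=c, ba=-c\rangle$; $A_{4,6}=\langle a,b,c,d\mid a^2=b, ab=ba=c\rangle$; $A_{4,7}=\langle a,b,c,d\mid a^2=bc=d, cb=-d\rangle$; $A_{4,8}^{\alpha,\beta}=\langle a,b,c,d\mid a^2=d, b^2=\alpha d, c^2=\beta d\rangle$; $A_{4,9}^{\alpha,\beta}=\langle a,b,c,d\mid a^2=\alpha d, b^2=d, bc=d, c^2=\beta d\rangle$; $A_{4,10}^\alpha=\langle a,b,c,d\mid a^2=d, ab=d, b^2=\alpha d, bc=d, cb=d\rangle$; $A_{4,11}=\langle a,b,c,d\mid a^2=d, ab=d, cb=d, c^2=-d\rangle$; $A_{4,12}=\langle a,b,c,d\mid a^2=b, ab=ba=d, ac=d, c^2=d\rangle$; $A_{4,13}=\langle a,b,c,d\mid a^2=b, ab=ba=d, c^2=d\rangle$; $A_{4,14}=\langle a,b,c,d\mid a^2=b, ab=ba=d,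 ac=d\rangle$; $A_{4,15}=\langle a,b,c,d\mid a^2=b, ab=ba=c, b^2=ac=ca=d\rangle$; $A_{4,16}=\langle a,b,c,d\mid a^2=c, ba=d\rangle$; $A_{4,18}^\delta=\langle a,b,c,d\mid a^2=c, ab=d, ba=-d, b^2=\delta c\rangle$; $A_{4,20}=\langle a,b,c,d\mid a^2=c, ab=d, ba=c\rangle$; $A_{4,21}^\delta=\langle a,b,c,d\mid a^2=c, ab=d, ba=\delta d\rangle$; $A_{4,23}^\delta=\langle a,b,c,d\mid a^2=c, ab=ba=d, b^2=-\delta c\rangle$; $A_{4,24}=\langle a,b,c,d\mid a^2=c, ab=d, ba=-c, b^2=c\rangle$; $A_{4,25}^{\alpha,\beta,\gamma}=\langle a,b,c,d\mid a^2=c, ab=d, ba=-\beta c+\alpha d, b^2=-\gamma c\rangle$. *)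

(* Defs.v *)
From HB Require Import structures.
From mathcomp Require Import all_boot all_order all_algebra sesquilinear.
From mathcomp Require Import reals.

Set Implicit Arguments.
Unset Strict Implicit.
Unset Printing Implicit Defensive.

Import Order.TTheory GRing.Theory Num.Theory.
Local Open Scope ring_scope.

(* MathComp's algebra structures are all unital, hence this record for finite
   dimensional algebras with no unit and (at first) no associativity. *)
Record algebra (F : fieldType) := Algebra {
  carrier :> vectType F;
  amul : {bilinear carrier -> carrier -> carrier}
}.

Definition assoc_algebra (F : fieldType) (A : algebra F) : Prop :=
  associative (@amul F A).

(* The product of x :: s is bracketed to the left; all bracketings agree since
   nilpotency is only considered together with [assoc_algebra]. *)
Definition nilpotent_algebra (F : fieldType) (A : algebra F) : Prop :=
  exists n : nat, forall (x : A) (s : seq A),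
    size s = n -> foldl (@amul F A) x s = 0.

Definition nilpotent_assoc_algebra_of_dim (n : nat) (F : fieldType)
    (A : algebra F) : Prop :=
  [/\ \dim {: A} = n, assoc_algebra A & nilpotent_algebra A].

Definition isomorphic (F : fieldType) (A B : algebra F) : Prop :=
  exists f : {linear A -> B},
    bijective f /\ forall x y : A, f (amul A x y) = amul B (f x) (f y).

Section Presented.
Variables (F : fieldType) (n : nat).

(* An entry (i, j, v) stands for the relation e_i e_j = v between the standard
   basis vectors; each pair (i, j) must occur at most once, and the pairs that
   do not occur have product 0. *)
Definition table := seq ('I_n * 'I_n * 'rV[F]_n).

Definition table_mul (t : table) (x y : 'rV[F]_n) : 'rV[F]_n :=
  \sum_(r <- t) (x 0 r.1.1 * y 0 r.1.2) *: r.2.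

Fact table_mul_bilinear (t : table) : bilinear_for *:%R *:%R (table_mul t).
Proof.
split=> [y a u v | x a u v]; rewrite /= /table_mul scaler_sumr -big_split /=;
  apply: eq_bigr => r _; rewrite !mxE.
- by rewrite mulrDl -mulrA scalerDl scalerA.
- by rewrite mulrDr mulrCA scalerDl scalerA.
Qed.

HB.instance Definition _ (t : table) :=
  bilinear_isBilinear.Build F 'rV[F]_n 'rV[F]_n 'rV[F]_n *:%R *:%R
    (table_mul t) (table_mul_bilinear t).

Lemma table_mul_basis (t : table) (i j : 'I_n) :
  table_mul t 'e_i 'e_j = \sum_(r <- t | r.1 == (i, j)) r.2.
Proof.
rewrite /table_mul [RHS]big_mkcond; apply: eq_bigr => -[[k l] v] _ /=.
rewrite !mxE /= xpair_eqE.
by do 2!case: eqVneq => _; rewrite ?mul0r ?mul1r ?scale1r ?scale0r.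
Qed.

Definition table_algebra (t : table) : algebra F :=
  @Algebra F 'rV[F]_n (table_mul t).

End Presented.

Inductive name (F : Type) :=
| A4_1 | A4_2 | A4_3 of F | A4_4 of F | A4_5 | A4_6 | A4_7
| A4_8 of F & F | A4_9 of F & F | A4_10 of F
| A4_11 | A4_12 | A4_13 | A4_14 | A4_15 | A4_16
| A4_18 of F | A4_20 | A4_21 of F | A4_23 of F | A4_24
| A4_25 of F & F & F.
Arguments A4_1 {F}.
Arguments A4_2 {F}.
Arguments A4_5 {F}.
Arguments A4_6 {F}.
Arguments A4_7 {F}.
Arguments A4_11 {F}.
Arguments A4_12 {F}.
Arguments A4_13 {F}.
Arguments A4_14 {F}.
Arguments A4_15 {F}.
Arguments A4_16 {F}.
Arguments A4_20 {F}.
Arguments A4_24 {F}.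

Definition a : 'I_4 := @Ordinal 4 0 isT.
Definition b : 'I_4 := @Ordinal 4 1 isT.
Definition c : 'I_4 := @Ordinal 4 2 isT.
Definition d : 'I_4 := @Ordinal 4 3 isT.

Definition relations (F : fieldType) (N : name F) : table F 4 :=
  match N with
  | A4_1 => [::]
  | A4_2 => [:: (a, a, 'e_b)]
  | A4_3 delta => [:: (a, a, 'e_c); (b, b, delta *: 'e_c)]
  | A4_4 delta => [:: (a, a, 'e_c); (b, b, delta *: 'e_c); (a, b, 'e_c)]
  | A4_5 => [:: (a, b, 'e_c); (b, a, - 'e_c)]
  | A4_6 => [:: (a, a, 'e_b); (a, b, 'e_c); (b, a, 'e_c)]
  | A4_7 => [:: (a, a, 'e_d); (b, c, 'e_d); (c, b, - 'e_d)]
  | A4_8 alpha beta =>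
      [:: (a, a, 'e_d); (b, b, alpha *: 'e_d); (c, c, beta *: 'e_d)]
  | A4_9 alpha beta =>
      [:: (a, a, alpha *: 'e_d); (b, b, 'e_d); (b, c, 'e_d);
          (c, c, beta *: 'e_d)]
  | A4_10 alpha =>
      [:: (a, a, 'e_d); (a, b, 'e_d); (b, b, alpha *: 'e_d);
          (b, c, 'e_d); (c, b, 'e_d)]
  | A4_11 => [:: (a, a, 'e_d); (a, b, 'e_d); (c, b, 'e_d); (c, c, - 'e_d)]
  | A4_12 => [:: (a, a, 'e_b); (a, b, 'e_d); (b, a, 'e_d);
                 (a, c, 'e_d); (c, c, 'e_d)]
  | A4_13 => [:: (a, a, 'e_b); (a, b, 'e_d); (b, a, 'e_d); (c, c, 'e_d)]
  | A4_14 => [:: (a, a, 'e_b); (a, b, 'e_d); (b, a, 'e_d); (a, c, 'e_d)]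
  | A4_15 => [:: (a, a, 'e_b); (a, b, 'e_c); (b, a, 'e_c);
                 (b, b, 'e_d); (a, c, 'e_d); (c, a, 'e_d)]
  | A4_16 => [:: (a, a, 'e_c); (b, a, 'e_d)]
  | A4_18 delta =>
      [:: (a, a, 'e_c); (a, b, 'e_d); (b, a, - 'e_d); (b, b, delta *: 'e_c)]
  | A4_20 => [:: (a, a, 'e_c); (a, b, 'e_d); (b, a, 'e_c)]
  | A4_21 delta => [:: (a, a, 'e_c); (a, b, 'e_d); (b, a, delta *: 'e_d)]
  | A4_23 delta =>
      [:: (a, a, 'e_c); (a, b, 'e_d); (b, a, 'e_d); (b, b, - delta *: 'e_c)]
  | A4_24 => [:: (a, a, 'e_c); (a, b, 'e_d); (b, a, - 'e_c); (b, b, 'e_c)]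
  | A4_25 alpha beta gamma =>
      [:: (a, a, 'e_c); (a, b, 'e_d); (b, a, - beta *: 'e_c + alpha *: 'e_d);
          (b, b, - gamma *: 'e_c)]
  end.

Definition algebra_of (F : fieldType) (N : name F) : algebra F :=
  table_algebra (relations N).

Definition listed (R : realType) (N : name R) : Prop :=
  match N with
  | A4_3 delta => delta = 1 \/ delta = -1
  | A4_8 alpha beta => alpha = 1 /\ (beta = 1 \/ beta = -1)
  | A4_9 alpha beta => alpha = 1 \/ (alpha = -1 /\ 4^-1 <= beta)
  | A4_10 alpha => alpha = 0
  | A4_18 delta => [\/ delta = 0, delta = 1 | delta = -1]
  | A4_21 delta => delta <> -1
  | A4_23 delta => delta = 1 \/ delta = -1
  | A4_25 alpha beta gamma =>
      -1 < alpha < 1 /\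
      (beta = 0 /\ (gamma = 1 \/ gamma = -1) \/
       beta = Num.sqrt 2 * (1 - alpha) /\ gamma = -1)
  | _ => True
  end.

(* Main.v *)
Require Import Defs.
From HB Require Import structures.
From mathcomp Require Import all_boot all_order all_algebra sesquilinear.
From mathcomp Require Import reals boolp.
From mathcomp Require Import ring lra zify.

(** Write A^k for the span of the products of k elements. Nilpotency makes the dimensions of
    A, A^2, A^3, ... decrease strictly down to 0, which leaves four possibilities.

    - dim A^2 = 3. Any x outside A^2 generates A, and x, x^2, x^3, x^4 is a basis: the algebra
      is [A4_15] ([classified_monogenic]).
    - dim A^2 = 2 and A^3 <> 0. Some z has z^3 <> 0, and a fourth vector completing z, z^2, z^3
      can be corrected so that associativity leaves two free coefficients, which are then
      rescaled to 0 or 1 ([classified_cube_nonzero], [classified_cubic]).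
    - dim A^2 <= 1. Then A^3 = 0 and the product is a bilinear form on a 3-dimensional space, up
      to congruence and a nonzero factor ([classified_form1]). Symmetric forms are
      diagonalised. Otherwise the skew part has a kernel spanned by one vector. Unless this
      vector is isotropic without being orthogonal to everything, it splits off, and a form on
      a plane remains, with the matrix of rows (1, 1), (0, k) if it is not alternating.
    - dim A^2 = 2 and A^3 = 0. The product is a pair of forms on a plane, up to congruence and
      a change of basis of the pencil that they span ([classified_form2]). In a noncommutative
      pencil the symmetric forms are the multiples of a single form S, of rank one, definite
      or indefinite. The other forms matter only modulo S and are normalised by their skew
      part; the remaining freedom is the group of similitudes of S, and the discriminant of
      the component orthogonal to S is an invariant of the algebra. For indefinite S this
      discriminant can have either sign, which accounts for the family with sqrt 2.

    Conversely, the listed algebras are told apart by properties that only mention the product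
    and hence are preserved by isomorphisms. They determine dim A^2 and whether A^3 = 0, then the
    ranks and signatures of the forms above. Three more of them recover the continuous
    parameters: the determinant of a form divided by the square of its skew part
    ([form_ratio] for [A4_4] and [A4_9]), the ratio of xy to yx for xx = 0 ([sq_null_ratio] for
    [A4_21]), and the same quotient of determinant and squared skew part for a form of the
    pencil orthogonal to S ([pencil_ratio] for [A4_25]). For [A4_25] its values are
    - al / (1 - al)^2 <= 1/4 and (1 + al^2) / (2 (1 - al)^2) > 1/4, each of them injective in the
    parameter al. *)

Set Implicit Arguments.
Unset Strict Implicit.
Unset Printing Implicit Defensive.

Import Order.TTheory GRing.Theory Num.Theory.
Local Open Scope ring_scope.

Local Notation "x ** y" := (amul _ x y) (at level 40, left associativity).

(* Simplification would unfold the tables behind [amul]; [amul_row4] evaluates products. *)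
Arguments algebra_of {F} N : simpl never.
Arguments table_algebra {F n} t : simpl never.

(** * Coordinates *)

Section Coordinates.
Variable F : fieldType.

Definition row4 (x1 x2 x3 x4 : F) : 'rV[F]_4 :=
  \row_(i < 4) nth 0 [:: x1; x2; x3; x4] i.

Lemma row4_ind (P : 'rV[F]_4 -> Prop) :
  (forall x1 x2 x3 x4, P (row4 x1 x2 x3 x4)) -> forall x, P x.
Proof.
move=> H x; have -> : x = row4 (x 0 a) (x 0 b) (x 0 c) (x 0 d) => //.
apply/rowP=> -[[|[|[|[|//]]]] i]; rewrite mxE /=; congr (x _ _); exact: val_inj.
Qed.

Lemma row4P x1 x2 x3 x4 y1 y2 y3 y4 :
  row4 x1 x2 x3 x4 = row4 y1 y2 y3 y4 <->
  [/\ x1 = y1, x2 = y2, x3 = y3 & x4 = y4].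
Proof.
split=> [/rowP H | [-> -> -> ->] //].
by split; [have:= H a|have:= H b|have:= H c|have:= H d]; rewrite !mxE.
Qed.

Lemma row4D x1 x2 x3 x4 y1 y2 y3 y4 :
  row4 x1 x2 x3 x4 + row4 y1 y2 y3 y4 =
  row4 (x1 + y1) (x2 + y2) (x3 + y3) (x4 + y4).
Proof. by apply/rowP=> -[[|[|[|[|//]]]] i]; rewrite !mxE. Qed.

Lemma row4N x1 x2 x3 x4 :
  - row4 x1 x2 x3 x4 = row4 (- x1) (- x2) (- x3) (- x4).
Proof. by apply/rowP=> -[[|[|[|[|//]]]] i]; rewrite !mxE. Qed.

Lemma row4Z k x1 x2 x3 x4 :
  k *: row4 x1 x2 x3 x4 = row4 (k * x1) (k * x2) (k * x3) (k * x4).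
Proof. by apply/rowP=> -[[|[|[|[|//]]]] i]; rewrite !mxE. Qed.

Lemma row40 : 0 = row4 0 0 0 0.
Proof. by apply/rowP=> -[[|[|[|[|//]]]] i]; rewrite !mxE. Qed.

Lemma row4_basis :
  ('e_a = row4 1 0 0 0) * ('e_b = row4 0 1 0 0) *
  ('e_c = row4 0 0 1 0) * ('e_d = row4 0 0 0 1).
Proof. by do !split; apply/rowP=> -[[|[|[|[|//]]]] i]; rewrite !mxE. Qed.

(** Expanding the tables once and for all turns every later statement on products into
    polynomial identities between coordinates. *)
Definition product (N : name F) (x1 x2 x3 x4 y1 y2 y3 y4 : F) : 'rV[F]_4 :=
  match N with
  | A4_1 => row4 0 0 0 0
  | A4_2 => row4 0 (x1 * y1) 0 0
  | A4_3 k => row4 0 0 (x1 * y1 + k * x2 * y2) 0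
  | A4_4 k => row4 0 0 (x1 * y1 + k * x2 * y2 + x1 * y2) 0
  | A4_5 => row4 0 0 (x1 * y2 - x2 * y1) 0
  | A4_6 => row4 0 (x1 * y1) (x1 * y2 + x2 * y1) 0
  | A4_7 => row4 0 0 0 (x1 * y1 + x2 * y3 - x3 * y2)
  | A4_8 k l => row4 0 0 0 (x1 * y1 + k * x2 * y2 + l * x3 * y3)
  | A4_9 k l =>
      row4 0 0 0 (k * x1 * y1 + x2 * y2 + x2 * y3 + l * x3 * y3)
  | A4_10 k =>
      row4 0 0 0 (x1 * y1 + x1 * y2 + k * x2 * y2 + x2 * y3 + x3 * y2)
  | A4_11 => row4 0 0 0 (x1 * y1 + x1 * y2 + x3 * y2 - x3 * y3)
  | A4_12 => row4 0 (x1 * y1) 0 (x1 * y2 + x2 * y1 + x1 * y3 + x3 * y3)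
  | A4_13 => row4 0 (x1 * y1) 0 (x1 * y2 + x2 * y1 + x3 * y3)
  | A4_14 => row4 0 (x1 * y1) 0 (x1 * y2 + x2 * y1 + x1 * y3)
  | A4_15 => row4 0 (x1 * y1) (x1 * y2 + x2 * y1)
                  (x2 * y2 + x1 * y3 + x3 * y1)
  | A4_16 => row4 0 0 (x1 * y1) (x2 * y1)
  | A4_18 k => row4 0 0 (x1 * y1 + k * x2 * y2) (x1 * y2 - x2 * y1)
  | A4_20 => row4 0 0 (x1 * y1 + x2 * y1) (x1 * y2)
  | A4_21 k => row4 0 0 (x1 * y1) (x1 * y2 + k * x2 * y1)
  | A4_23 k => row4 0 0 (x1 * y1 - k * x2 * y2) (x1 * y2 + x2 * y1)
  | A4_24 => row4 0 0 (x1 * y1 - x2 * y1 + x2 * y2) (x1 * y2)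
  | A4_25 k l m =>
      row4 0 0 (x1 * y1 - l * x2 * y1 - m * x2 * y2) (x1 * y2 + k * x2 * y1)
  end.

Lemma amul_row4 N x1 x2 x3 x4 y1 y2 y3 y4 :
  amul (algebra_of N) (row4 x1 x2 x3 x4) (row4 y1 y2 y3 y4) =
  product N x1 x2 x3 x4 y1 y2 y3 y4.
Proof.
case: N => *; rewrite /algebra_of /table_algebra /= /table_mul ?big_cons big_nil /=;
rewrite ?row4_basis ?[row4 _ _ _ _ 0 _]mxE /= row40 ?(row4N, row4Z, row4D);
by apply/row4P; split; ring.
Qed.

End Coordinates.

(** * Isomorphisms given by a basis *)

Section Isomorphisms.
Variable F : fieldType.
Implicit Types A B C : algebra F.

Lemma amulDl A x y z : amul A (x + y) z = amul A x z + amul A y z.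
Proof. exact: linearDl. Qed.
Lemma amulDr A x y z : amul A z (x + y) = amul A z x + amul A z y.
Proof. exact: linearDr. Qed.
Lemma amulZl A k x y : amul A (k *: x) y = k *: amul A x y.
Proof. exact: linearZl_LR. Qed.
Lemma amulZr A k x y : amul A x (k *: y) = k *: amul A x y.
Proof. exact: linearZr_LR. Qed.
Lemma amulBl A x y z : amul A (x - y) z = amul A x z - amul A y z.
Proof. exact: linearBl. Qed.
Lemma amulBr A x y z : amul A z (x - y) = amul A z x - amul A z y.
Proof. exact: linearBr. Qed.
Lemma amul_suml A I (r : seq I) (P : pred I) E x :
  amul A (\sum_(i <- r | P i) E i) x = \sum_(i <- r | P i) amul A (E i) x.
Proof. exact: linear_sumlz. Qed.
Lemma amul_sumr A I (r : seq I) (P : pred I) E x :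
  amul A x (\sum_(i <- r | P i) E i) = \sum_(i <- r | P i) amul A x (E i).
Proof. exact: linear_sumr. Qed.

Lemma isomorphic_trans A B C :
  isomorphic A B -> isomorphic B C -> isomorphic A C.
Proof.
move=> [f [bf fM]] [g [bg gM]]; exists (g \o f); split; first exact: bij_comp.
by move=> x y /=; rewrite fM gM.
Qed.

Lemma isomorphic_sym A B : isomorphic A B -> isomorphic B A.
Proof.
move=> [f [[g fK gK] fM]].
have gL : linear g.
  by move=> k x y; apply: (can_inj fK); rewrite gK linearP !gK.
pose gl : {linear B -> A} :=
  HB.pack_for {linear B -> A} g (GRing.isLinear.Build _ _ _ _ g gL).
exists gl; split; first by exists f.
by move=> x y /=; apply: (can_inj fK); rewrite fM !gK.
Qed.

Definition comb (V : lmodType F) (e : 'I_4 -> V) (x : 'rV[F]_4) : V :=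
  \sum_(i < 4) x 0 i *: e i.

Lemma comb_linear (V : lmodType F) (e : 'I_4 -> V) : linear (comb e).
Proof.
move=> k x y; rewrite /comb scaler_sumr -big_split /=; apply: eq_bigr => i _.
by rewrite !mxE scalerDl scalerA.
Qed.
HB.instance Definition _ (V : lmodType F) (e : 'I_4 -> V) :=
  GRing.isLinear.Build _ _ _ _ (comb e) (comb_linear e).

Lemma comb_amul A (t : table F 4) (e : 'I_4 -> A) :
  (forall i j, amul A (e i) (e j) = comb e (table_mul t 'e_i 'e_j)) ->
  forall x y, comb e (table_mul t x y) = amul A (comb e x) (comb e y).
Proof.
move=> eM x y; have tE i z : table_mul t 'e_i z =
    \sum_j z 0 j *: table_mul t 'e_i 'e_j.
  rewrite {1}(row_sum_delta z) (amul_sumr (A := table_algebra t)).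
  by apply: eq_bigr => j _; exact: (amulZr (A := table_algebra t)).
rewrite {1}(row_sum_delta x) (amul_suml (A := table_algebra t)) linear_sum /=.
rewrite /comb amul_suml; apply: eq_bigr => i _.
rewrite [in LHS](amulZl (A := table_algebra t)) amulZl amul_sumr.
rewrite -/(comb e _) linearZ /= tE; congr (_ *: _); rewrite (linear_sum (comb e)) /=.
by apply: eq_bigr => j _; rewrite linearZ /= amulZr eM.
Qed.

Lemma isomorphic_of_basis A (t : table F 4) (e : 4.-tuple A) :
  \dim {: A} = 4 -> free e ->
  (forall i j : 'I_4,
     amul A e`_i e`_j = comb (fun i : 'I_4 => e`_i) (table_mul t 'e_i 'e_j)) ->
  isomorphic A (table_algebra t).
Proof.
move=> dimA fe eM; apply: isomorphic_sym.
exists (comb (fun i : 'I_4 => e`_i)); split; last exact: comb_amul.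
have be : basis_of fullv e by rewrite basisEfree fe subvf dimA size_tuple.
exists (fun v => \row_i coord e i v) => [x | v].
  by apply/rowP=> i; rewrite mxE coord_sum_free.
rewrite [RHS](coord_basis be (memvf v)).
by apply: eq_bigr => i _; rewrite mxE.
Qed.

(** A left inverse suffices, since a one-sided inverse of a square matrix is two-sided. *)
Lemma isomorphic_table (t t' : table F 4) (e e' : 'I_4 -> 'rV[F]_4) :
  cancel (comb e') (comb e) ->
  (forall x y,
     comb e' (table_mul t' x y) = table_mul t (comb e' x) (comb e' y)) ->
  isomorphic (table_algebra t) (table_algebra t').
Proof.
move=> eK eM; apply: isomorphic_sym; exists (comb e'); split => //.
have combE f (x : 'rV[F]_4) : comb f x = x *m (\matrix_i f i) :> 'rV[F]_4.
  by rewrite mulmx_sum_row; apply: eq_bigr => i _; rewrite rowK.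
have /mulmx1C e'e : (\matrix_i e' i) *m (\matrix_i e i) = 1%:M.
  by apply/row_matrixP=> i; rewrite !rowE mulmxA -!combE eK mulmx1.
exists (comb e) => // x.
by rewrite -[LHS]/(comb e' (comb e x)) !combE -mulmxA e'e mulmx1.
Qed.

Definition fam4 (T : Type) (x1 x2 x3 x4 : T) (i : 'I_4) : T :=
  match nat_of_ord i with 0 => x1 | 1 => x2 | 2 => x3 | _ => x4 end%N.

Lemma comb_fam4 (V : lmodType F) (e1 e2 e3 e4 : V) x1 x2 x3 x4 :
  comb (fam4 e1 e2 e3 e4) (row4 x1 x2 x3 x4) =
  x1 *: e1 + x2 *: e2 + x3 *: e3 + x4 *: e4.
Proof.
by rewrite /comb !big_ord_recl big_ord0 !mxE addr0 !addrA.
Qed.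

End Isomorphisms.

(** * The listed algebras, and three families of models *)

Section Models.
Variable F : fieldType.

Lemma algebra_of_assoc (N : name F) : assoc_algebra (algebra_of N).
Proof.
elim/row4_ind=> x1 x2 x3 x4; elim/row4_ind=> y1 y2 y3 y4.
elim/row4_ind=> z1 z2 z3 z4; rewrite !amul_row4.
by case: N => *; rewrite /product !amul_row4 /product; apply/row4P; split; ring.
Qed.

Lemma algebra_of_nilpotent (N : name F) : nilpotent_algebra (algebra_of N).
Proof.
exists 4; elim/row4_ind=> x1 x2 x3 x4 [|+[|+[|+[|+[|//]]]]] //.
elim/row4_ind=> y1 y2 y3 y4; elim/row4_ind=> z1 z2 z3 z4.
elim/row4_ind=> t1 t2 t3 t4; elim/row4_ind=> u1 u2 u3 u4 _.
rewrite /foldl; rewrite (amul_row4 N x1 x2 x3 x4).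
case: N => *; rewrite /product; do 3!rewrite amul_row4 /product;
by rewrite row40; apply/row4P; split; ring.
Qed.

Lemma algebra_of_nilpotent_assoc (N : name F) :
  nilpotent_assoc_algebra_of_dim 4 (algebra_of N).
Proof.
split; [by rewrite dimvf | exact: algebra_of_assoc | exact: algebra_of_nilpotent].
Qed.

(** A bilinear form (m_ij) on the space spanned by [a], [b], [c], with values in the line of
    [d]: every algebra with A^3 = 0 and dim A^2 <= 1 has this shape. *)
Definition form1 (m11 m12 m13 m21 m22 m23 m31 m32 m33 : F) : algebra F :=
  table_algebra [:: (a, a, m11 *: 'e_d); (a, b, m12 *: 'e_d);
    (a, c, m13 *: 'e_d); (b, a, m21 *: 'e_d); (b, b, m22 *: 'e_d);
    (b, c, m23 *: 'e_d); (c, a, m31 *: 'e_d); (c, b, m32 *: 'e_d);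
    (c, c, m33 *: 'e_d)].

(** A pair of bilinear forms on the plane spanned by [a] and [b]: the shape of the algebras
    with A^3 = 0 and dim A^2 = 2. *)
Definition form2 (m11 m12 m21 m22 n11 n12 n21 n22 : F) : algebra F :=
  table_algebra [:: (a, a, m11 *: 'e_c + n11 *: 'e_d);
    (a, b, m12 *: 'e_c + n12 *: 'e_d); (b, a, m21 *: 'e_c + n21 *: 'e_d);
    (b, b, m22 *: 'e_c + n22 *: 'e_d)].

(** The shape of the algebras with A^3 <> 0 = A^4 and dim A^2 = 2. Here [a], [b], [d] are
    the powers of one element, and associativity leaves only [p] and [r] free. *)
Definition cubic (p r : F) : algebra F :=
  table_algebra [:: (a, a, 'e_b); (a, b, 'e_d); (b, a, 'e_d);
    (a, c, p *: 'e_d); (c, c, r *: 'e_d)].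

Lemma form1_row4 m11 m12 m13 m21 m22 m23 m31 m32 m33 x1 x2 x3 x4 y1 y2 y3 y4 :
  amul (form1 m11 m12 m13 m21 m22 m23 m31 m32 m33)
    (row4 x1 x2 x3 x4) (row4 y1 y2 y3 y4) =
  row4 0 0 0 (x1 * (m11 * y1 + m12 * y2 + m13 * y3)
            + x2 * (m21 * y1 + m22 * y2 + m23 * y3)
            + x3 * (m31 * y1 + m32 * y2 + m33 * y3)).
Proof.
rewrite /= /form1 /table_algebra /= /table_mul !big_cons big_nil /=.
rewrite ?row4_basis ?[row4 _ _ _ _ 0 _]mxE /= row40 ?(row4N, row4Z, row4D).
by apply/row4P; split; ring.
Qed.

Lemma form2_row4 m11 m12 m21 m22 n11 n12 n21 n22 x1 x2 x3 x4 y1 y2 y3 y4 :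
  amul (form2 m11 m12 m21 m22 n11 n12 n21 n22)
    (row4 x1 x2 x3 x4) (row4 y1 y2 y3 y4) =
  row4 0 0 (x1 * (m11 * y1 + m12 * y2) + x2 * (m21 * y1 + m22 * y2))
           (x1 * (n11 * y1 + n12 * y2) + x2 * (n21 * y1 + n22 * y2)).
Proof.
rewrite /= /form2 /table_algebra /= /table_mul !big_cons big_nil /=.
rewrite ?row4_basis ?[row4 _ _ _ _ 0 _]mxE /= row40 ?(row4N, row4Z, row4D).
by apply/row4P; split; ring.
Qed.

Lemma cubic_row4 p r x1 x2 x3 x4 y1 y2 y3 y4 :
  amul (cubic p r) (row4 x1 x2 x3 x4) (row4 y1 y2 y3 y4) =
  row4 0 (x1 * y1) 0 (x1 * y2 + x2 * y1 + p * x1 * y3 + r * x3 * y3).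
Proof.
rewrite /= /cubic /table_algebra /= /table_mul !big_cons big_nil /=.
rewrite ?row4_basis ?[row4 _ _ _ _ 0 _]mxE /= row40 ?(row4N, row4Z, row4D).
by apply/row4P; split; ring.
Qed.

End Models.
Arguments form1 : simpl never.
Arguments form2 : simpl never.
Arguments cubic : simpl never.

Definition mulE :=
  (@form1_row4, @form2_row4, @cubic_row4, @amul_row4).

(** To compare two algebras on row vectors: [s] is the basis of the second algebra written
    in the first one, [r] the inverse change of basis. There remain four equations saying
    that they are inverse, and four saying that the products agree. *)
Tactic Notation "new_basis" uconstr(s) uconstr(r) :=
  lazymatch goal with |- isomorphic ?A ?B =>
    refine (@isomorphic_table _ _ _ r s _ _);
    [ elim/row4_ind=> ? ? ? ?
    | elim/row4_ind=> ? ? ? ?; elim/row4_ind=> ? ? ? ?;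
      rewrite -?[table_mul _]/(amul A : _ -> _ -> _)
              -?[table_mul _]/(amul B : _ -> _ -> _) ];
    rewrite !(comb_fam4, row4Z, row4D) ?mulE /product
            ?(comb_fam4, row4Z, row4D);
    apply/row4P; split
  end.

Ltac field_nz := field; do ?[apply/andP; split]; try done.

Section Classified.
Variable R : realType.
Implicit Types A B : algebra R.

Definition classified A := exists2 N : name R, listed N & isomorphic A (algebra_of N).

Lemma classified_isomorphic A B : isomorphic A B -> classified B -> classified A.
Proof.
by move=> AB [N lN BN]; exists N => //; exact: isomorphic_trans AB BN.
Qed.

(** Replacing [a] by [s a] and [c] by [t c] multiplies [p] by t / s^2 and [r] by t^2 / s^3,
    so that each of them can be made 0 or 1. *)
Lemma classified_cubic (p r : R) : classified (cubic p r).
Proof.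
have [-> | p0] := eqVneq p 0; have [-> | r0] := eqVneq r 0.
- exists A4_6 => //.
  by new_basis (fam4 (row4 1 0 0 0) (row4 0 1 0 0) (row4 0 0 0 1) (row4 0 0 1 0))
               (fam4 (row4 1 0 0 0) (row4 0 1 0 0) (row4 0 0 0 1) (row4 0 0 1 0)); ring.
- exists A4_13 => //.
  by new_basis (fam4 (row4 r 0 0 0) (row4 0 (r ^+ 2) 0 0) (row4 0 0 r 0)
                     (row4 0 0 0 (r ^+ 3)))
               (fam4 (row4 r^-1 0 0 0) (row4 0 (r ^- 2) 0 0) (row4 0 0 r^-1 0)
                     (row4 0 0 0 (r ^- 3))); field.
- exists A4_14 => //.
  by new_basis (fam4 (row4 1 0 0 0) (row4 0 1 0 0) (row4 0 0 p^-1 0) (row4 0 0 0 1))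
               (fam4 (row4 1 0 0 0) (row4 0 1 0 0) (row4 0 0 p 0) (row4 0 0 0 1)); field.
- exists A4_12 => //; pose s := p ^+ 2 / r.
  have s0 : s != 0 by rewrite mulf_neq0 ?expf_neq0 ?invr_neq0.
  by new_basis (fam4 (row4 s 0 0 0) (row4 0 (s ^+ 2) 0 0) (row4 0 0 (s ^+ 2 / p) 0)
                     (row4 0 0 0 (s ^+ 3)))
               (fam4 (row4 s^-1 0 0 0) (row4 0 (s ^- 2) 0 0) (row4 0 0 (p / s ^+ 2) 0)
                     (row4 0 0 0 (s ^- 3))); rewrite /s; field_nz.
Qed.

End Classified.

(** * Symmetric forms with values in a line *)

Section Form1.
Variable R : realType.

(** Over the reals, the sign is the only obstruction to making a coefficient 1 by rescaling
    a basis vector. *)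
Lemma sign_square (x : R) :
  exists e w, [/\ w != 0, x = e * w ^+ 2 & [\/ e = 0, e = 1 | e = -1]].
Proof.
have [x0 | x0 | ->] := ltrgt0P x.
- exists 1, (Num.sqrt x); rewrite sqrtr_eq0 -ltNge sqr_sqrtr ?(ltW x0) // mul1r.
  by split=> //; exact: Or32.
- exists (-1), (Num.sqrt (- x)).
  rewrite sqrtr_eq0 -ltNge sqr_sqrtr ?oppr_ge0 ?(ltW x0) // mulN1r opprK oppr_gt0.
  by split=> //; exact: Or33.
by exists 0, 1; rewrite oner_neq0 mul0r; split=> //; exact: Or31.
Qed.

Lemma classified_diag (p s u : R) : p != 0 ->
  classified (form1 p 0 0 0 s 0 0 0 u).
Proof.
move=> p0; have [e [w [w0 se e01]]] := sign_square (s / p).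
have [f [v [v0 uf f01]]] := sign_square (u / p).
have {se}-> : s = e * w ^+ 2 * p by rewrite -se divfK.
have {uf}-> : u = f * v ^+ 2 * p by rewrite -uf divfK.
case: e01 => ->; case: f01 => ->.
- exists A4_2 => //.
  by new_basis (fam4 (row4 1 0 0 0) (row4 0 0 0 p) (row4 0 1 0 0) (row4 0 0 1 0))
               (fam4 (row4 1 0 0 0) (row4 0 0 1 0) (row4 0 0 0 1) (row4 0 p^-1 0 0));
    field.
- exists (A4_3 1); first by left.
  by new_basis (fam4 (row4 1 0 0 0) (row4 0 0 v^-1 0) (row4 0 0 0 p) (row4 0 1 0 0))
               (fam4 (row4 1 0 0 0) (row4 0 0 0 1) (row4 0 v 0 0) (row4 0 0 p^-1 0));
    field_nz.
- exists (A4_3 (-1)); first by right.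
  by new_basis (fam4 (row4 1 0 0 0) (row4 0 0 v^-1 0) (row4 0 0 0 p) (row4 0 1 0 0))
               (fam4 (row4 1 0 0 0) (row4 0 0 0 1) (row4 0 v 0 0) (row4 0 0 p^-1 0));
    field_nz.
- exists (A4_3 1); first by left.
  by new_basis (fam4 (row4 1 0 0 0) (row4 0 w^-1 0 0) (row4 0 0 0 p) (row4 0 0 1 0))
               (fam4 (row4 1 0 0 0) (row4 0 w 0 0) (row4 0 0 0 1) (row4 0 0 p^-1 0));
    field_nz.
- exists (A4_8 1 1); first by split; auto.
  by new_basis (fam4 (row4 1 0 0 0) (row4 0 w^-1 0 0) (row4 0 0 v^-1 0) (row4 0 0 0 p))
               (fam4 (row4 1 0 0 0) (row4 0 w 0 0) (row4 0 0 v 0) (row4 0 0 0 p^-1));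
    field_nz.
- exists (A4_8 1 (-1)); first by split; auto.
  by new_basis (fam4 (row4 1 0 0 0) (row4 0 w^-1 0 0) (row4 0 0 v^-1 0) (row4 0 0 0 p))
               (fam4 (row4 1 0 0 0) (row4 0 w 0 0) (row4 0 0 v 0) (row4 0 0 0 p^-1));
    field_nz.
- exists (A4_3 (-1)); first by right.
  by new_basis (fam4 (row4 1 0 0 0) (row4 0 w^-1 0 0) (row4 0 0 0 p) (row4 0 0 1 0))
               (fam4 (row4 1 0 0 0) (row4 0 w 0 0) (row4 0 0 0 1) (row4 0 0 p^-1 0));
    field_nz.
- exists (A4_8 1 (-1)); first by split; auto.
  by new_basis (fam4 (row4 1 0 0 0) (row4 0 0 v^-1 0) (row4 0 w^-1 0 0) (row4 0 0 0 p))
               (fam4 (row4 1 0 0 0) (row4 0 0 w 0) (row4 0 v 0 0) (row4 0 0 0 p^-1));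
    field_nz.
- exists (A4_8 1 (-1)); first by split; auto.
  (* Negating [d] leaves one negative square, which is put last. *)
  by new_basis (fam4 (row4 0 w^-1 0 0) (row4 0 0 v^-1 0) (row4 1 0 0 0)
                     (row4 0 0 0 (- p)))
               (fam4 (row4 0 0 1 0) (row4 w 0 0 0) (row4 0 v 0 0) (row4 0 0 0 (- p^-1)));
    field_nz.
Qed.

Lemma classified_diag_block (p s t u : R) : p != 0 ->
  classified (form1 p 0 0 0 s t 0 t u).
Proof.
move=> p0.
have s_ne0 (s' t' u' : R) : s' != 0 -> classified (form1 p 0 0 0 s' t' 0 t' u').
  move=> s0; apply: classified_isomorphic (classified_diag s' (u' - t' ^+ 2 / s') p0).
  by new_basis (fam4 (row4 1 0 0 0) (row4 0 1 0 0) (row4 0 (- (t' / s')) 1 0)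
                     (row4 0 0 0 1))
               (fam4 (row4 1 0 0 0) (row4 0 1 0 0) (row4 0 (t' / s') 1 0) (row4 0 0 0 1));
    field.
have [-> | /s_ne0 //] := eqVneq s 0; have [-> | u0] := eqVneq u 0; last first.
  apply: classified_isomorphic (s_ne0 u t 0 u0).
  by new_basis (fam4 (row4 1 0 0 0) (row4 0 0 1 0) (row4 0 1 0 0) (row4 0 0 0 1))
               (fam4 (row4 1 0 0 0) (row4 0 0 1 0) (row4 0 1 0 0) (row4 0 0 0 1));
    ring.
have [-> | t0] := eqVneq t 0; first exact: classified_diag.
apply: classified_isomorphic (s_ne0 (2 * t) t 0 _); last by rewrite mulf_neq0 ?pnatr_eq0.
by new_basis (fam4 (row4 1 0 0 0) (row4 0 1 1 0) (row4 0 0 1 0) (row4 0 0 0 1))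
             (fam4 (row4 1 0 0 0) (row4 0 1 (-1) 0) (row4 0 0 1 0) (row4 0 0 0 1));
  ring.
Qed.

(** Gauss reduction. A vector with nonzero square splits off an orthogonal line, and a
    nonzero symmetric form has such a vector: if all basis vectors have square zero, the sum
    of two of them with nonzero product does not. *)
Lemma classified_sym (p q r s t u : R) :
  classified (form1 p q r q s t r t u).
Proof.
have p_ne0 (p' q' r' s' t' u' : R) : p' != 0 ->
    classified (form1 p' q' r' q' s' t' r' t' u').
  move=> p0; apply: classified_isomorphic (classified_diag_block
    (s' - q' ^+ 2 / p') (t' - q' * r' / p') (u' - r' ^+ 2 / p') p0).
  by new_basis (fam4 (row4 1 0 0 0) (row4 (- (q' / p')) 1 0 0)
                     (row4 (- (r' / p')) 0 1 0) (row4 0 0 0 1))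
               (fam4 (row4 1 0 0 0) (row4 (q' / p') 1 0 0)
                     (row4 (r' / p') 0 1 0) (row4 0 0 0 1)); field.
have s_ne0 (p' q' r' s' t' u' : R) : s' != 0 ->
    classified (form1 p' q' r' q' s' t' r' t' u').
  move=> s0; apply: classified_isomorphic (p_ne0 s' q' t' p' r' u' s0).
  by new_basis (fam4 (row4 0 1 0 0) (row4 1 0 0 0) (row4 0 0 1 0) (row4 0 0 0 1))
               (fam4 (row4 0 1 0 0) (row4 1 0 0 0) (row4 0 0 1 0) (row4 0 0 0 1)); ring.
have [-> | /p_ne0 //] := eqVneq p 0; have [-> | /s_ne0 //] := eqVneq s 0.
have [-> | u0] := eqVneq u 0; last first.
  apply: classified_isomorphic (p_ne0 u t r 0 q 0 u0).
  by new_basis (fam4 (row4 0 0 1 0) (row4 0 1 0 0) (row4 1 0 0 0) (row4 0 0 0 1))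
               (fam4 (row4 0 0 1 0) (row4 0 1 0 0) (row4 1 0 0 0) (row4 0 0 0 1)); ring.
have q_ne0 (q' r' t' : R) : q' != 0 -> classified (form1 0 q' r' q' 0 t' r' t' 0).
  move=> q0; apply: classified_isomorphic (p_ne0 (2 * q') q' (r' + t') 0 t' 0 _);
    last by rewrite mulf_neq0 ?pnatr_eq0.
  by new_basis (fam4 (row4 1 1 0 0) (row4 0 1 0 0) (row4 0 0 1 0) (row4 0 0 0 1))
               (fam4 (row4 1 (-1) 0 0) (row4 0 1 0 0) (row4 0 0 1 0) (row4 0 0 0 1));
    ring.
have [-> | /q_ne0 //] := eqVneq q 0; have [-> | r0] := eqVneq r 0; last first.
  apply: classified_isomorphic (q_ne0 r 0 t r0).
  by new_basis (fam4 (row4 1 0 0 0) (row4 0 0 1 0) (row4 0 1 0 0) (row4 0 0 0 1))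
               (fam4 (row4 1 0 0 0) (row4 0 0 1 0) (row4 0 1 0 0) (row4 0 0 0 1)); ring.
have [-> | t0] := eqVneq t 0; last first.
  apply: classified_isomorphic (q_ne0 t 0 0 t0).
  by new_basis (fam4 (row4 0 1 0 0) (row4 0 0 1 0) (row4 1 0 0 0) (row4 0 0 0 1))
               (fam4 (row4 0 0 1 0) (row4 1 0 0 0) (row4 0 1 0 0) (row4 0 0 0 1)); ring.
exists A4_1 => //.
by new_basis (fam4 (row4 1 0 0 0) (row4 0 1 0 0) (row4 0 0 1 0) (row4 0 0 0 1))
             (fam4 (row4 1 0 0 0) (row4 0 1 0 0) (row4 0 0 1 0) (row4 0 0 0 1)); ring.
Qed.

End Form1.

(** * Nonsymmetric forms with values in a line *)

Section SkewForm1.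
Variable R : realType.

(** The normal position of a nonsymmetric form: [d] is the commutator of [a] and [b], and
    [c] is central, that is, in the kernel of the skew part. *)
Definition skew1 (p q r s t u : R) := form1 p (q + 1) r q s t r t u.

(** For a parameter below 1/4, the form on the plane of [b] and [c] is indefinite, and the
    vector c - b/2 has square - w^2 d, of the sign opposite to the square of [b]. Building
    the normal form from this vector changes the sign of the form but not its parameter,
    which is a quotient of quantities of degree two. *)
Lemma A4_9_opp (w : R) : w != 0 ->
  isomorphic (algebra_of (A4_9 (-1) (4^-1 - w ^+ 2)))
             (algebra_of (A4_9 1 (4^-1 - w ^+ 2))).
Proof.
move=> w0.
by new_basis (fam4 (row4 w 0 0 0) (row4 0 (- 2^-1) 1 0)
                   (row4 0 (w ^+ 2 - 4^-1) 2^-1 0) (row4 0 0 0 (- w ^+ 2)))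
             (fam4 (row4 w^-1 0 0 0) (row4 0 (- 2^-1 / w ^+ 2) (w ^- 2) 0)
                   (row4 0 ((w ^+ 2 - 4^-1) / w ^+ 2) (2^-1 / w ^+ 2) 0)
                   (row4 0 0 0 (- w ^- 2))); field_nz.
Qed.

Lemma classified_A4_9 (e k : R) : e = 1 \/ e = -1 ->
  classified (algebra_of (A4_9 e k)).
Proof.
have refl N : isomorphic (algebra_of N) (algebra_of N : algebra R).
  exists idfun; split=> //; exact: (Bijective (g := idfun)).
case=> ->; first by exists (A4_9 1 k) => //; left.
have [k14 | k14] := leP 4^-1 k; first by exists (A4_9 (-1) k) => //; right.
exists (A4_9 1 k); first by left.
have -> : k = 4^-1 - Num.sqrt (4^-1 - k) ^+ 2.
  by rewrite sqr_sqrtr ?subr_ge0 1?ltW // opprB addrC subrK.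
by apply: A4_9_opp; rewrite sqrtr_eq0 -ltNge subr_gt0.
Qed.

(** The central vector [c] splits off orthogonally, and the plane of [a] and [b] remains. If
    some vector of this plane, taken as [a], has a nonzero square, then subtracting from [b]
    a multiple of [a] achieves ba = 0 and gives the matrix with rows (1, 1) and (0, k).
    Otherwise the form on this plane is alternating. *)
Lemma classified_skew1_split (p q s u : R) : classified (skew1 p q 0 s 0 u).
Proof.
have p_ne0 (p' q' s' : R) : p' != 0 -> classified (skew1 p' q' 0 s' 0 u).
  move=> p0; have [-> | u0] := eqVneq u 0.
    (* The parameter is the determinant of the form on the plane of [a] and [b]. *)
    exists (A4_4 (p' * s' - q' * (q' + 1))) => //; rewrite /skew1.
    by new_basis (fam4 (row4 1 0 0 0) (row4 (- q') p' 0 0) (row4 0 0 0 p') (row4 0 0 1 0))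
                 (fam4 (row4 1 0 0 0) (row4 (q' / p') p'^-1 0 0) (row4 0 0 0 1)
                       (row4 0 0 p'^-1 0)); field_nz.
  have [e [w [w0 eq_pu e01]]] := sign_square (p' / u).
  have pE : p' = e * w ^+ 2 * u by rewrite -eq_pu divfK.
  have e0 : e != 0 by apply: contra_neq p0 => e0; rewrite pE e0 !mul0r.
  have e1 : e * e = 1.
    by case: e01 e0 => -> //; rewrite ?eqxx // ?mulrNN mulr1.
  apply: classified_isomorphic (@classified_A4_9 e (p' * s' - q' * (q' + 1)) _);
    last first.
    by case: e01 e0 => ->; rewrite ?eqxx; auto.
  rewrite /skew1.
  by new_basis (fam4 (row4 0 0 w 0) (row4 1 0 0 0) (row4 (- q') p' 0 0) (row4 0 0 0 p'))
               (fam4 (row4 0 1 0 0) (row4 0 (q' / p') p'^-1 0) (row4 w^-1 0 0 0)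
                     (row4 0 0 0 p'^-1));
    rewrite ?[w * _]mulrC; try (by field_nz); rewrite pE; ring: e1.
have [-> | /p_ne0 //] := eqVneq p 0; have [-> | s0] := eqVneq s 0; last first.
  apply: classified_isomorphic (p_ne0 s (- (q + 1)) 0 s0); rewrite /skew1.
  by new_basis (fam4 (row4 0 1 0 0) (row4 (-1) 0 0 0) (row4 0 0 1 0) (row4 0 0 0 1))
               (fam4 (row4 0 (-1) 0 0) (row4 1 0 0 0) (row4 0 0 1 0) (row4 0 0 0 1));
    ring.
have [q0 | q0] := eqVneq (2 * q + 1) 0; last first.
  apply: classified_isomorphic (p_ne0 _ q 0 q0); rewrite /skew1.
  by new_basis (fam4 (row4 1 1 0 0) (row4 0 1 0 0) (row4 0 0 1 0) (row4 0 0 0 1))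
               (fam4 (row4 1 (-1) 0 0) (row4 0 1 0 0) (row4 0 0 1 0) (row4 0 0 0 1));
    ring.
have -> : q = - 2^-1 by lra.
rewrite /skew1; have [-> | u0] := eqVneq u 0.
  exists A4_5 => //.
  by new_basis (fam4 (row4 1 0 0 0) (row4 0 1 0 0) (row4 0 0 0 2^-1) (row4 0 0 1 0))
               (fam4 (row4 1 0 0 0) (row4 0 1 0 0) (row4 0 0 0 1) (row4 0 0 2 0)); field.
exists A4_7 => //.
by new_basis (fam4 (row4 0 0 1 0) (row4 1 0 0 0) (row4 0 (2 * u) 0 0) (row4 0 0 0 u))
             (fam4 (row4 0 1 0 0) (row4 0 0 (2 * u)^-1 0) (row4 1 0 0 0)
                   (row4 0 0 0 u^-1));
  field_nz.
Qed.

(** The central vector [c] either has a nonzero square or is orthogonal to everything, and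
    then it splits off; or it is isotropic but not orthogonal to [b], say. In the last case
    [b] and [c] can be made a hyperbolic pair, and only the square of [a] is left in the
    form. *)
Lemma classified_skew1 (p q r s t u : R) : classified (skew1 p q r s t u).
Proof.
have [-> | u0] := eqVneq u 0; last first.
  apply: classified_isomorphic (classified_skew1_split
    (p - r ^+ 2 / u) (q - r * t / u) (s - t ^+ 2 / u) u); rewrite /skew1.
  by new_basis (fam4 (row4 1 0 (- (r / u)) 0) (row4 0 1 (- (t / u)) 0)
                     (row4 0 0 1 0) (row4 0 0 0 1))
               (fam4 (row4 1 0 (r / u) 0) (row4 0 1 (t / u) 0)
                     (row4 0 0 1 0) (row4 0 0 0 1)); field_nz.
have normal (k : R) : classified (skew1 k 0 0 0 1 0).
  rewrite /skew1; have [-> | k0] := eqVneq k 0.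
    exists A4_11 => //; apply: isomorphic_sym.
    by new_basis (fam4 (row4 1 (-1) (-1) 0) (row4 1 (-1) 0 0) (row4 1 0 (-1) 0)
                       (row4 0 0 0 1))
                 (fam4 (row4 (-1) 1 1 0) (row4 (-1) 0 1 0) (row4 (-1) 1 0 0)
                       (row4 0 0 0 1)); ring.
  exists (A4_10 0) => //.
  by new_basis (fam4 (row4 1 0 0 0) (row4 0 k 0 0) (row4 0 0 1 0) (row4 0 0 0 k))
               (fam4 (row4 1 0 0 0) (row4 0 k^-1 0 0) (row4 0 0 1 0)
                     (row4 0 0 0 k^-1)); field_nz.
have t_ne0 (p' q' r' s' t' : R) : t' != 0 -> classified (skew1 p' q' r' s' t' 0).
  move=> t0; pose k := r' / t'; pose l := (q' - k * s') / t'.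
  apply: classified_isomorphic (normal (p' - k * (2 * q' + 1) + k ^+ 2 * s')).
  rewrite /skew1.
  by new_basis (fam4 (row4 1 (- k) (- l) 0) (row4 0 1 (- (s' / (2 * t'))) 0)
                     (row4 0 0 t'^-1 0) (row4 0 0 0 1))
               (fam4 (row4 1 k (k * s' / 2 + (q' - k * s')) 0) (row4 0 1 (s' / 2) 0)
                     (row4 0 0 t' 0) (row4 0 0 0 1)); rewrite /l /k; field_nz.
have [-> | /t_ne0 //] := eqVneq t 0; have [-> | r0] := eqVneq r 0.
  exact: classified_skew1_split.
rewrite -oppr_eq0 in r0.
apply: classified_isomorphic (t_ne0 s (- (q + 1)) 0 p _ r0); rewrite /skew1.
by new_basis (fam4 (row4 0 1 0 0) (row4 (-1) 0 0 0) (row4 0 0 1 0) (row4 0 0 0 1))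
             (fam4 (row4 0 (-1) 0 0) (row4 1 0 0 0) (row4 0 0 1 0) (row4 0 0 0 1)); ring.
Qed.

(** If the form is not symmetric, two of the three basis vectors do not commute, and the
    third one becomes central after subtracting multiples of these two. *)
Lemma classified_form1 (m11 m12 m13 m21 m22 m23 m31 m32 m33 : R) :
  classified (form1 m11 m12 m13 m21 m22 m23 m31 m32 m33).
Proof.
have skew (n11 n12 n13 n21 n22 n23 n31 n32 n33 : R) : n12 - n21 != 0 ->
    classified (form1 n11 n12 n13 n21 n22 n23 n31 n32 n33).
  set k := n12 - n21 => k0; pose x := (n32 - n23) / k; pose y := (n13 - n31) / k.
  apply: classified_isomorphic (classified_skew1
    (n11 / k) (n21 / k) ((n13 - x * n11 - y * n12) / k) (n22 / k)
    ((n23 - x * n21 - y * n22) / k)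
    ((n33 - x * (n13 + n31) - y * (n23 + n32) + x ^+ 2 * n11
      + x * y * (n12 + n21) + y ^+ 2 * n22) / k)).
  rewrite /skew1.
  by new_basis (fam4 (row4 1 0 0 0) (row4 0 1 0 0) (row4 (- x) (- y) 1 0) (row4 0 0 0 k))
               (fam4 (row4 1 0 0 0) (row4 0 1 0 0) (row4 x y 1 0) (row4 0 0 0 k^-1));
    rewrite /x /y /k; field_nz.
have [/eqP | /skew //] := eqVneq (m12 - m21) 0; rewrite subr_eq0 => /eqP->.
have [/eqP | m13_31] := eqVneq (m13 - m31) 0; last first.
  apply: classified_isomorphic (skew m11 m13 m21 m31 m33 m32 m21 m23 m22 m13_31).
  by new_basis (fam4 (row4 1 0 0 0) (row4 0 0 1 0) (row4 0 1 0 0) (row4 0 0 0 1))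
               (fam4 (row4 1 0 0 0) (row4 0 0 1 0) (row4 0 1 0 0) (row4 0 0 0 1)); ring.
rewrite subr_eq0 => /eqP->.
have [/eqP | m23_32] := eqVneq (m23 - m32) 0; last first.
  apply: classified_isomorphic (skew m22 m23 m21 m32 m33 m31 m21 m31 m11 m23_32).
  by new_basis (fam4 (row4 0 1 0 0) (row4 0 0 1 0) (row4 1 0 0 0) (row4 0 0 0 1))
               (fam4 (row4 0 0 1 0) (row4 1 0 0 0) (row4 0 1 0 0) (row4 0 0 0 1)); ring.
by rewrite subr_eq0 => /eqP->; exact: classified_sym.
Qed.

End SkewForm1.

(** * Pairs of forms on a plane *)

Section Form2.
Variable R : realType.

Lemma classified_form2_rank1 (m11 m12 m21 m22 : R) :
  classified (form2 m11 m12 m21 m22 0 0 0 0).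
Proof.
apply: classified_isomorphic (classified_form1 m11 m12 0 m21 m22 0 0 0 0).
by new_basis (fam4 (row4 1 0 0 0) (row4 0 1 0 0) (row4 0 0 0 1) (row4 0 0 1 0))
             (fam4 (row4 1 0 0 0) (row4 0 1 0 0) (row4 0 0 0 1) (row4 0 0 1 0)); ring.
Qed.

Lemma form2_swap_cd (m11 m12 m21 m22 n11 n12 n21 n22 : R) :
  isomorphic (form2 m11 m12 m21 m22 n11 n12 n21 n22)
             (form2 n11 n12 n21 n22 m11 m12 m21 m22).
Proof.
by new_basis (fam4 (row4 1 0 0 0) (row4 0 1 0 0) (row4 0 0 0 1) (row4 0 0 1 0))
             (fam4 (row4 1 0 0 0) (row4 0 1 0 0) (row4 0 0 0 1) (row4 0 0 1 0)); ring.
Qed.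

Definition sym2 (p q r s t u : R) := form2 p q q r s t t u.

Lemma classified_sym2_normal (e : R) : [\/ e = 0, e = 1 | e = -1] ->
  classified (sym2 1 0 e 0 1 0).
Proof.
rewrite /sym2; case=> ->; [exists (A4_21 1) | exists (A4_23 (-1)) | exists (A4_23 1)];
  rewrite /=; try (by left); try (by right); try (by lra);
by new_basis (fam4 (row4 1 0 0 0) (row4 0 1 0 0) (row4 0 0 1 0) (row4 0 0 0 1))
             (fam4 (row4 1 0 0 0) (row4 0 1 0 0) (row4 0 0 1 0) (row4 0 0 0 1)); ring.
Qed.

(** Completing the square makes bb a multiple of aa, and the sign of the multiple is what
    distinguishes the normal forms. If aa and bb span while ab = 0, then a + b and a - b
    have equal squares. *)
Lemma classified_sym2_split (r t u : R) : classified (sym2 1 0 r 0 t u).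
Proof.
have [-> | t0] := eqVneq t 0.
  have [-> | u0] := eqVneq u 0; first exact: classified_form2_rank1.
  rewrite /sym2; exists (A4_23 (-1)); first by right.
  by new_basis (fam4 (row4 1 1 0 0) (row4 1 (-1) 0 0) (row4 0 0 (1 + r) u)
                     (row4 0 0 (1 - r) (- u)))
               (fam4 (row4 2^-1 2^-1 0 0) (row4 2^-1 (- 2^-1) 0 0) (row4 0 0 2^-1 2^-1)
                     (row4 0 0 ((1 - r) / (2 * u)) (- (1 + r) / (2 * u)))); field_nz.
have [k ->] : exists k, u = k * (2 * t).
  by exists (u / (2 * t)); rewrite divfK // mulf_neq0 ?pnatr_eq0.
have [e [w [w0 rE e01]]] := sign_square (r + k ^+ 2).
have -> : r = e * w ^+ 2 - k ^+ 2 by rewrite -rE addrK.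
apply: classified_isomorphic (classified_sym2_normal e01); rewrite /sym2.
by new_basis (fam4 (row4 1 0 0 0) (row4 (- k / w) w^-1 0 0) (row4 0 0 1 0)
                     (row4 0 0 (- k / w) (t / w)))
               (fam4 (row4 1 0 0 0) (row4 k w 0 0) (row4 0 0 1 0)
                     (row4 0 0 (k / t) (w / t))); field_nz.
Qed.

Lemma classified_sym2 (p q r s t u : R) : classified (sym2 p q r s t u).
Proof.
have p_ne0 (p' q' r' s' t' u' : R) : p' != 0 -> classified (sym2 p' q' r' s' t' u').
  move=> p0; pose k := q' / p'; pose r0 := (r' - k * q') / p'.
  apply: classified_isomorphic (classified_sym2_split r0
    (t' - k * s') (u' - k * t' *+ 2 + k ^+ 2 * s' - s' * r0)); rewrite /sym2.
  by new_basis (fam4 (row4 1 0 0 0) (row4 (- k) 1 0 0) (row4 0 0 p' s') (row4 0 0 0 1))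
               (fam4 (row4 1 0 0 0) (row4 k 1 0 0) (row4 0 0 p'^-1 (- s' / p'))
                     (row4 0 0 0 1));
    rewrite /r0 /k; field_nz.
have s_ne0 (p' q' r' s' t' u' : R) : s' != 0 -> classified (sym2 p' q' r' s' t' u').
  by move=> s0; apply: classified_isomorphic (p_ne0 s' t' u' p' q' r' s0);
    exact: form2_swap_cd.
have swap_ab (p' q' r' s' t' u' : R) :
    isomorphic (sym2 p' q' r' s' t' u') (sym2 r' q' p' u' t' s').
  rewrite /sym2.
  by new_basis (fam4 (row4 0 1 0 0) (row4 1 0 0 0) (row4 0 0 1 0) (row4 0 0 0 1))
               (fam4 (row4 0 1 0 0) (row4 1 0 0 0) (row4 0 0 1 0) (row4 0 0 0 1)); ring.
have [-> | /p_ne0 //] := eqVneq p 0; have [-> | /s_ne0 //] := eqVneq s 0.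
have [-> | /p_ne0 r0] := eqVneq r 0;
  last exact: classified_isomorphic (swap_ab _ _ _ _ _ _) _.
have [-> | /s_ne0 u0] := eqVneq u 0;
  last exact: classified_isomorphic (swap_ab _ _ _ _ _ _) _.
have sum : isomorphic (sym2 0 q 0 0 t 0) (sym2 (2 * q) q 0 (2 * t) t 0).
  rewrite /sym2.
  by new_basis (fam4 (row4 1 1 0 0) (row4 0 1 0 0) (row4 0 0 1 0) (row4 0 0 0 1))
               (fam4 (row4 1 (-1) 0 0) (row4 0 1 0 0) (row4 0 0 1 0) (row4 0 0 0 1));
    ring.
have [q0 | q0] := eqVneq q 0; last first.
  by apply: classified_isomorphic sum (p_ne0 _ _ _ _ _ _ _); rewrite mulf_neq0 ?pnatr_eq0.
have [-> | t0] := eqVneq t 0; first by rewrite q0; exact: classified_form2_rank1.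
by apply: classified_isomorphic sum (s_ne0 _ _ _ _ _ _ _); rewrite mulf_neq0 ?pnatr_eq0.
Qed.

(** The normal position of a noncommutative pair: [d] is the commutator of [a] and [b], so
    that the form with values in [c] is symmetric. *)
Definition skew2 (p q r s t u : R) := form2 p q q r s (t + 1) t u.

Lemma skew2_opp_b (r t u : R) : isomorphic (skew2 1 0 r 0 t u) (skew2 1 0 r 0 t (- u)).
Proof.
rewrite /skew2.
by new_basis (fam4 (row4 1 0 0 0) (row4 0 (-1) 0 0) (row4 0 0 1 0) (row4 0 0 0 (-1)))
             (fam4 (row4 1 0 0 0) (row4 0 (-1) 0 0) (row4 0 0 1 0) (row4 0 0 0 (-1)));
  ring.
Qed.

(** The symmetric form has rank one, with [b] in its radical. If bb <> 0, a multiple of [b]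
    added to [a] achieves ba = 0. If bb = 0, such a change of [a] leaves ab and ba as they
    are and their ratio remains as a parameter. *)
Lemma classified_skew2_null (t u : R) : classified (skew2 1 0 0 0 t u).
Proof.
rewrite /skew2; have [-> | u0] := eqVneq u 0; last first.
  exists A4_24 => //; pose k := t / u.
  by new_basis (fam4 (row4 1 (- k) 0 0) (row4 (-1) (u^-1 + k) 0 0)
                     (row4 0 0 1 (- k * (t + 1))) (row4 0 0 (-1) (u^-1 + k * (t + 1))))
               (fam4 (row4 (1 + t) t 0 0) (row4 u u 0 0)
                     (row4 0 0 (1 + t * (t + 1)) (t * (t + 1))) (row4 0 0 u u));
    rewrite /k; field_nz.
have [-> | t1] := eqVneq t (-1).
  exists A4_16 => //.
  by new_basis (fam4 (row4 1 0 0 0) (row4 0 1 0 0) (row4 0 0 1 0) (row4 0 0 0 (-1)))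
               (fam4 (row4 1 0 0 0) (row4 0 1 0 0) (row4 0 0 1 0) (row4 0 0 0 (-1)));
    ring.
have {}t1 : t + 1 != 0 by rewrite -[1]opprK subr_eq0.
have [-> | t2] := eqVneq t (- 2^-1).
  exists (A4_18 0); first exact: Or31.
  by new_basis (fam4 (row4 1 0 0 0) (row4 0 1 0 0) (row4 0 0 1 0) (row4 0 0 0 2^-1))
               (fam4 (row4 1 0 0 0) (row4 0 1 0 0) (row4 0 0 1 0) (row4 0 0 0 2)); field.
exists (A4_21 (t / (t + 1))) => /=.
  move=> /(congr1 ( *%R^~ (t + 1))); rewrite divfK // => tE.
  by case/eqP: t2; lra.
by new_basis (fam4 (row4 1 0 0 0) (row4 0 1 0 0) (row4 0 0 1 0) (row4 0 0 0 (t + 1)))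
             (fam4 (row4 1 0 0 0) (row4 0 1 0 0) (row4 0 0 1 0)
                   (row4 0 0 0 (t + 1)^-1)); field_nz.
Qed.

(** Exchanging [a] and [b] replaces [t] by - (t + 1), so one may assume t >= -1/2. Then the
    ratio t / (t + 1) of ba to ab lies in the interval from -1 included to 1 excluded. *)
Lemma classified_skew2_balanced (e t : R) : e = 1 \/ e = -1 ->
  classified (skew2 1 0 e 0 t 0).
Proof.
move=> e1; have large (t' : R) : - 2^-1 <= t' -> classified (skew2 1 0 e 0 t' 0).
  rewrite le_eqVlt => /predU1P[<- | t2].
    exists (A4_18 e); first by case: e1 => ->; [exact: Or32 | exact: Or33].
    rewrite /skew2.
    by new_basis (fam4 (row4 1 0 0 0) (row4 0 1 0 0) (row4 0 0 1 0) (row4 0 0 0 2^-1))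
                 (fam4 (row4 1 0 0 0) (row4 0 1 0 0) (row4 0 0 1 0) (row4 0 0 0 2));
      field.
  have t1 : 0 < t' + 1 by lra.
  have t10 : t' + 1 != 0 by rewrite gt_eqF.
  exists (A4_25 (t' / (t' + 1)) 0 (- e)).
    split; first by rewrite ltr_pdivrMr // ltr_pdivlMr //; apply/andP; split; lra.
    by left; split=> //; case: e1 => ->; rewrite ?opprK; auto.
  rewrite /skew2.
  by new_basis (fam4 (row4 1 0 0 0) (row4 0 1 0 0) (row4 0 0 1 0) (row4 0 0 0 (t' + 1)))
               (fam4 (row4 1 0 0 0) (row4 0 1 0 0) (row4 0 0 1 0)
                     (row4 0 0 0 (t' + 1)^-1));
    field_nz.
have [/large // | t2] := leP (- 2^-1) t.
apply: classified_isomorphic (large (- (t + 1)) _); last by lra.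
rewrite /skew2; case: e1 => ->.
  by new_basis (fam4 (row4 0 1 0 0) (row4 1 0 0 0) (row4 0 0 1 0) (row4 0 0 0 (-1)))
               (fam4 (row4 0 1 0 0) (row4 1 0 0 0) (row4 0 0 1 0) (row4 0 0 0 (-1)));
    ring.
by new_basis (fam4 (row4 0 1 0 0) (row4 1 0 0 0) (row4 0 0 (-1) 0) (row4 0 0 0 (-1)))
             (fam4 (row4 0 1 0 0) (row4 1 0 0 0) (row4 0 0 (-1) 0) (row4 0 0 0 (-1)));
  ring.
Qed.

(** The new basis k a + b, k b - e a is orthogonal for the symmetric form diag(1, e). The
    hypothesis on [t] says that the component of the second form that is orthogonal to
    diag(1, e) vanishes on k a + b, hence also on the other vector. *)
Lemma classified_skew2_rotate (e u k : R) : e = 1 \/ e = -1 ->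
  k != 0 -> k ^+ 2 + e != 0 ->
  classified (skew2 1 0 e 0 (u * (e * k ^+ 2 - 1) / (4 * k) - 2^-1) u).
Proof.
move=> e1 k0 n0; pose t := u * (e * k ^+ 2 - 1) / (4 * k) - 2^-1.
apply: classified_isomorphic (classified_skew2_balanced
   ((u * k - e * (t + 1) + k ^+ 2 * t) / (k ^+ 2 + e)) e1).
rewrite /skew2 /t; case: e1 n0 => -> n0.
  by new_basis (fam4 (row4 k 1 0 0) (row4 (- 1) k 0 0)
                     (row4 0 0 (k ^+ 2 + 1) ((k ^+ 2 + 1) * (u / 2)))
                     (row4 0 0 0 (k ^+ 2 + 1)))
               (fam4 (row4 (k / (k ^+ 2 + 1)) (- (k ^+ 2 + 1)^-1) 0 0)
                     (row4 (k ^+ 2 + 1)^-1 (k / (k ^+ 2 + 1)) 0 0)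
                     (row4 0 0 (k ^+ 2 + 1)^-1 (- (u / 2) / (k ^+ 2 + 1)))
                     (row4 0 0 0 (k ^+ 2 + 1)^-1)); field_nz.
by new_basis (fam4 (row4 k 1 0 0) (row4 1 k 0 0)
                   (row4 0 0 (k ^+ 2 - 1) (- (k ^+ 2 - 1) * (u / 2)))
                   (row4 0 0 0 (k ^+ 2 - 1)))
             (fam4 (row4 (k / (k ^+ 2 - 1)) (- (k ^+ 2 - 1)^-1) 0 0)
                   (row4 (- (k ^+ 2 - 1)^-1) (k / (k ^+ 2 - 1)) 0 0)
                   (row4 0 0 (k ^+ 2 - 1)^-1 ((u / 2) / (k ^+ 2 - 1)))
                   (row4 0 0 0 (k ^+ 2 - 1)^-1)); field_nz.
Qed.

(** The traceless part of the second form is indefinite and hence has an isotropic vector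
    k a + b; [k] is a root of a quadratic equation. *)
Lemma classified_skew2_definite (t u : R) : classified (skew2 1 0 1 0 t u).
Proof.
have [-> | u0] := eqVneq u 0; first by apply: classified_skew2_balanced; left.
(* [h / 2] is the symmetric part of the products ab and ba. *)
pose h := 2 * t + 1; pose k := (h + Num.sqrt (h ^+ 2 + u ^+ 2)) / u.
have eq_k : u * (k ^+ 2 - 1) = 2 * h * k.
  have /sqr_sqrtr := addr_ge0 (sqr_ge0 h) (sqr_ge0 u).
  rewrite /k; set r := Num.sqrt _ => rE; apply/eqP; rewrite -subr_eq0; apply/eqP.
  transitivity ((r ^+ 2 - (h ^+ 2 + u ^+ 2)) / u); first by field.
  by rewrite rE subrr mul0r.
have k0 : k != 0.
  by apply: contra_neq u0 => k0; move: eq_k; rewrite k0; lra.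
have -> : t = u * (1 * k ^+ 2 - 1) / (4 * k) - 2^-1.
  by rewrite mul1r eq_k /h; field.
apply: classified_skew2_rotate => //; first by left.
by rewrite gt_eqF // ltr_pwDr ?sqr_ge0.
Qed.

(** The vectors a + b and a - b are isotropic for the symmetric form, and the square of
    a - b vanishes as well. In [A4_20] the vectors with these properties are 2a - b and [b]. *)
Lemma isomorphic_A4_20 (u : R) : u != 0 ->
  isomorphic (skew2 1 0 (-1) 0 ((u - 1) / 2) u) (algebra_of A4_20).
Proof.
move=> u0; rewrite /skew2.
by new_basis (fam4 (row4 ((1 + u) / 2) ((1 - u) / 2) 0 0) (row4 u (- u) 0 0)
                   (row4 0 0 u (u / 2 - u ^+ 2 / 2))
                   (row4 0 0 u (- (u / 2) - u ^+ 2 / 2)))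
             (fam4 (row4 1 ((1 - u) / (2 * u)) 0 0) (row4 1 (- (1 + u) / (2 * u)) 0 0)
                   (row4 0 0 (2^-1 + 1 / (2 * u)) ((1 - u) / (2 * u)))
                   (row4 0 0 u^-1 (- u^-1))); field_nz.
Qed.

(** The squares of the isotropic vectors e+ = a + b and e- = a - b of the symmetric form are
    the multiples r / k and r k of [d]. With q = 1 - sqrt 2, the vectors e+ + (q / k) e- and
    q e+ + k^-1 e- have equal squares, as the relations of [A4_25] require; the number
    sqrt 2 comes from the equation 1 + q^2 = - 2 sqrt 2 q for the ratio of the coordinates. *)
Lemma isomorphic_A4_25_sqrt2 (k r : R) : k != 0 -> r < 0 ->
  isomorphic
    (skew2 1 0 (-1) 0 (r * (k^-1 - k) / 4 - 2^-1) (r * (k + k^-1) / 2))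
    (algebra_of (A4_25 ((r + 1) / (r - 1))
                       (Num.sqrt 2 * (1 - (r + 1) / (r - 1))) (-1))).
Proof.
move=> k0 r0; pose q : R := 1 - Num.sqrt 2.
have q2 : q ^+ 2 = 1 + 2 * q.
  have /sqr_sqrtr s2 : 0 <= 2 :> R by [].
  by rewrite /q; move: s2; set s := Num.sqrt _ => s2; ring: s2.
have -> : Num.sqrt 2 = 1 - q by rewrite /q opprB addrCA subrr addr0.
have q0 : q != 0 by apply: contra_eq_neq q2 => ->;
  rewrite expr0n mulr0 addr0 eq_sym oner_neq0.
have r1 : r - 1 != 0 by rewrite lt_eqF //; lra.
clearbody q.
pose u := r * (k + k^-1) / 2.
pose g1 := 4 * q / k; pose g2 := r * (2 + 2 * q) / k.
pose d1 := 2 * (2 + 2 * q) / k; pose d2 := 2 * q * (r + 1) / k.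
pose D := 8 * q ^+ 2 * (1 - r) / k ^+ 2.
have r2 : 1 - r != 0 by rewrite -opprB oppr_eq0.
rewrite /skew2.
by new_basis (fam4 (row4 (1 + q / k) (1 - q / k) 0 0) (row4 (q + k^-1) (q - k^-1) 0 0)
                (row4 0 0 g1 (g2 - g1 * (u / 2))) (row4 0 0 d1 (d2 - d1 * (u / 2))))
  (fam4 (row4 ((1 - k * q) / (- 4 * q)) ((- q + k) / (- 4 * q)) 0 0)
        (row4 ((1 + k * q) / (- 4 * q)) ((- q - k) / (- 4 * q)) 0 0)
        (row4 0 0 ((d2 - d1 * (u / 2)) / D) ((- g2 + g1 * (u / 2)) / D))
        (row4 0 0 (- d1 / D) (g1 / D)));
  rewrite /D /d1 /d2 /g1 /g2 /u; first [by field_nz | field: q2; do ?[apply/andP; split]].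
Qed.

(** Let h = 2 t + 1. The isotropic vectors a + b and a - b of the symmetric form have the
    squares (u + h) d and (u - h) d. If these have opposite signs, the component of the
    second form that is orthogonal to the first one has an isotropic vector, and a rotation
    applies. If they have the same sign, sqrt 2 enters. If one of them is zero and the other
    is not, the algebra is [A4_20]. *)
Lemma classified_skew2_indefinite (t u : R) : classified (skew2 1 0 (-1) 0 t u).
Proof.
pose h := 2 * t + 1.
have [-> | u0] := eqVneq u 0; first by apply: classified_skew2_balanced; right.
have tE : t = (h - 1) / 2 by rewrite /h; field.
have [h2u2 | u2h2 | h2u2] := ltrgtP (u ^+ 2) (h ^+ 2).
- pose k := (- h + Num.sqrt (h ^+ 2 - u ^+ 2)) / u.
  have eq_k : u * (k ^+ 2 + 1) = - (2 * h * k).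
    have /sqr_sqrtr : 0 <= h ^+ 2 - u ^+ 2 by rewrite subr_ge0 ltW.
    rewrite /k; set r := Num.sqrt _ => rE; apply/eqP; rewrite -subr_eq0; apply/eqP.
    transitivity ((r ^+ 2 - (h ^+ 2 - u ^+ 2)) / u); first by field.
    by rewrite rE subrr mul0r.
  have k0 : k != 0.
    by apply: contra_neq u0 => k0; move: eq_k; rewrite k0; lra.
  have n0 : k ^+ 2 + (-1) != 0.
    apply/eqP => n0; have k2 : k ^+ 2 = 1 by lra.
    suff : u ^+ 2 = h ^+ 2 by move/eqP; rewrite lt_eqF.
    have -> : u = - h * k by move: eq_k; rewrite k2; lra.
    by rewrite exprMn k2 sqrrN mulr1.
  have -> : t = u * (-1 * k ^+ 2 - 1) / (4 * k) - 2^-1.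
    have -> : u * (-1 * k ^+ 2 - 1) = - (u * (k ^+ 2 + 1)) by ring.
    by rewrite eq_k tE; field.
  by apply: classified_skew2_rotate => //; right.
- have neg (v : R) : v < 0 -> v ^+ 2 = u ^+ 2 -> classified (skew2 1 0 (-1) 0 t v).
    move=> v0 v2; have P0 : v + h < 0.
      rewrite -[h]opprK subr_lt0; rewrite ltNge; apply/negP => hv.
      have : u ^+ 2 <= h ^+ 2 by rewrite -v2; nra.
      by rewrite leNgt u2h2.
    have Q0 : v - h < 0.
      rewrite subr_lt0; rewrite ltNge; apply/negP => hv.
      have : u ^+ 2 <= h ^+ 2 by rewrite -v2; nra.
      by rewrite leNgt u2h2.
    (* The squares of a + b and a - b are to be r / k and r k. *)
    pose k := Num.sqrt ((v - h) / (v + h)).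
    have QP0 : 0 < (v - h) / (v + h) by rewrite nmulr_rgt0 ?invr_lt0.
    have k0 : k != 0 by rewrite gt_eqF ?sqrtr_gt0.
    have k2 : k ^+ 2 * (v + h) = v - h by rewrite sqr_sqrtr ?ltW // divfK ?lt_eqF.
    pose r := (v + h) * k.
    have r0 : r < 0 by rewrite nmulr_rlt0 // sqrtr_gt0.
    have vE : v = r * (k + k^-1) / 2.
      transitivity ((k ^+ 2 * (v + h) + (v + h)) / 2); first by rewrite k2; field.
      by rewrite /r; field.
    have -> : t = r * (k^-1 - k) / 4 - 2^-1.
      transitivity (((v + h) - k ^+ 2 * (v + h)) / 4 - 2^-1); first by
        rewrite k2 tE; field.
      by rewrite /r; field.
    rewrite vE; exists (A4_25 ((r + 1) / (r - 1))
                       (Num.sqrt 2 * (1 - (r + 1) / (r - 1))) (-1)).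
      split; last by right.
      have r1 : r - 1 < 0 by lra.
      by rewrite ltr_ndivrMr // ltr_ndivlMr //; apply/andP; split; lra.
    exact: isomorphic_A4_25_sqrt2.
  have [un | up | uz] := ltrgtP u 0; first exact: neg.
    apply: classified_isomorphic (skew2_opp_b _ _ _) (neg _ _ _).
      by rewrite oppr_lt0.
    by rewrite sqrrN.
  by rewrite uz eqxx in u0.
- have base (v : R) : v != 0 -> v = h -> classified (skew2 1 0 (-1) 0 t v).
    by move=> v0 vh; exists A4_20 => //; rewrite tE -vh; exact: isomorphic_A4_20.
  move/eqP: h2u2; rewrite eqf_sqr => /orP[/eqP|/eqP] uh; first exact: base.
  apply: classified_isomorphic (skew2_opp_b _ _ _) (base _ _ _).
    by rewrite oppr_eq0.
  by rewrite uh opprK.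
Qed.

(** Gauss reduction of the symmetric form to diag(1, e) with e = 0, 1 or -1. Adding a
    multiple of [d] to [c] then removes the square of [a] from the second form. *)
Lemma classified_skew2 (p q r s t u : R) : classified (skew2 p q r s t u).
Proof.
have p_ne0 (p' q' r' s' t' u' : R) : p' != 0 -> classified (skew2 p' q' r' s' t' u').
  move=> p0; have [k ->] : exists k, q' = k * p' by exists (q' / p'); rewrite divfK.
  have [e [w [w0 rE e01]]] := sign_square (r' / p' - k ^+ 2).
  have -> : r' = (k ^+ 2 + e * w ^+ 2) * p' by rewrite -rE addrC subrK divfK.
  have H (t2 u2 : R) : classified (skew2 1 0 e 0 t2 u2).
    case: e01 => ->; [exact: classified_skew2_null | exact: classified_skew2_definite
      | exact: classified_skew2_indefinite].
  apply: classified_isomorphic (H (t' - k * s')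
    ((u' - k * (2 * t' + 1) + k ^+ 2 * s') / w - e * w * s')).
  rewrite /skew2.
  by new_basis (fam4 (row4 1 0 0 0) (row4 (- k / w) w^-1 0 0)
                     (row4 0 0 p' s') (row4 0 0 0 w^-1))
               (fam4 (row4 1 0 0 0) (row4 k w 0 0)
                     (row4 0 0 p'^-1 (- s' * w / p')) (row4 0 0 0 w)); field_nz.
have [-> | /p_ne0 //] := eqVneq p 0; have [-> | r0] := eqVneq r 0; last first.
  apply: classified_isomorphic (p_ne0 r (- q) 0 u (- (t + 1)) s r0); rewrite /skew2.
  by new_basis (fam4 (row4 0 1 0 0) (row4 (-1) 0 0 0) (row4 0 0 1 0) (row4 0 0 0 1))
               (fam4 (row4 0 (-1) 0 0) (row4 1 0 0 0) (row4 0 0 1 0) (row4 0 0 0 1));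
    ring.
have [-> | q0] := eqVneq q 0; last first.
  apply: classified_isomorphic (p_ne0 (2 * q) q 0 (s + (2 * t + 1) + u) (t + u) u _);
    last by rewrite mulf_neq0 ?pnatr_eq0.
  rewrite /skew2.
  by new_basis (fam4 (row4 1 1 0 0) (row4 0 1 0 0) (row4 0 0 1 0) (row4 0 0 0 1))
               (fam4 (row4 1 (-1) 0 0) (row4 0 1 0 0) (row4 0 0 1 0) (row4 0 0 0 1));
    ring.
exact: classified_isomorphic (form2_swap_cd _ _ _ _ _ _ _ _)
  (classified_form2_rank1 _ _ _ _).
Qed.

Lemma classified_form2 (m11 m12 m21 m22 n11 n12 n21 n22 : R) :
  classified (form2 m11 m12 m21 m22 n11 n12 n21 n22).
Proof.
have skew (p11 p12 p21 p22 q11 q12 q21 q22 : R) : q12 - q21 != 0 ->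
    classified (form2 p11 p12 p21 p22 q11 q12 q21 q22).
  set k := q12 - q21 => k0; pose l := (p12 - p21) / k.
  apply: classified_isomorphic (classified_skew2 (p11 - l * q11) (p12 - l * q12)
    (p22 - l * q22) (q11 / k) (q21 / k) (q22 / k)); rewrite /skew2.
  by new_basis (fam4 (row4 1 0 0 0) (row4 0 1 0 0) (row4 0 0 1 0) (row4 0 0 (l * k) k))
               (fam4 (row4 1 0 0 0) (row4 0 1 0 0) (row4 0 0 1 0) (row4 0 0 (- l) k^-1));
    rewrite /l /k; field_nz.
have [/eqP | /skew //] := eqVneq (n12 - n21) 0; rewrite subr_eq0 => /eqP->.
have [/eqP | m0] := eqVneq (m12 - m21) 0.
  by rewrite subr_eq0 => /eqP->; exact: classified_sym2.
by apply: classified_isomorphic (form2_swap_cd _ _ _ _ _ _ _ _) (skew _ _ _ _ _ _ _ _ m0).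
Qed.

End Form2.

(** * The powers of an algebra *)

Section Powers.
Variables (F : fieldType) (A : algebra F).
Implicit Types (U V W : {vspace A}) (x y z : A).

Definition prodv (U V : {vspace A}) : {vspace A} :=
  <<[seq x ** y | x <- vbasis U, y <- vbasis V]>>%VS.

Lemma memv_amul U V x y : x \in U -> y \in V -> x ** y \in prodv U V.
Proof.
move=> /coord_vbasis-> /coord_vbasis->; rewrite amul_suml rpred_sum // => i _.
rewrite amul_sumr rpred_sum // => j _; rewrite amulZl amulZr !rpredZ //.
by apply/memv_span/allpairs_f; apply: mem_nth; rewrite size_tuple.
Qed.

Lemma prodv_sub U V (W : {vspace A}) :
  (forall x y, x \in U -> y \in V -> x ** y \in W) -> (prodv U V <= W)%VS.
Proof.
move=> UVW; apply/span_subvP => _ /allpairsP[[x y] [/= xU yV ->]].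
by apply: UVW; exact: vbasis_mem.
Qed.

(** Membership of a product in [W] need only be checked on the generators of one factor,
    because the elements with this property form the preimage of [W] under a linear map. *)
Lemma prodv_ind_r U V (W : {vspace A}) x z : z \in prodv U V ->
  (forall u v, u \in U -> v \in V -> x ** (u ** v) \in W) -> x ** z \in W.
Proof.
move=> zUV UVW; pose f := linfun (amul A x).
suff /subvP/(_ z zUV) : (prodv U V <= f @^-1: W)%VS by rewrite -memv_preim lfunE.
by apply: prodv_sub => u v uU vV; rewrite -memv_preim lfunE; exact: UVW.
Qed.

Lemma prodv_ind_l U V (W : {vspace A}) x z : z \in prodv U V ->
  (forall u v, u \in U -> v \in V -> (u ** v) ** x \in W) -> z ** x \in W.
Proof.
move=> zUV UVW; pose f := linfun (applyr (amul A) x).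
suff /subvP/(_ z zUV) : (prodv U V <= f @^-1: W)%VS by rewrite -memv_preim lfunE.
by apply: prodv_sub => u v uU vV; rewrite -memv_preim lfunE; exact: UVW.
Qed.

(** The ideal usually written A^(k+1): the index counts multiplications, as in the
    definition of nilpotency. *)
Fixpoint power (k : nat) : {vspace A} :=
  if k is k'.+1 then prodv (power k') fullv else fullv.

Lemma power_le k : (power k.+1 <= power k)%VS.
Proof.
elim: k => [|k IH]; first exact: subvf.
by apply: prodv_sub => x y /(subvP IH) xk yf; exact: memv_amul.
Qed.

Lemma power_anti i j : (i <= j)%N -> (power j <= power i)%VS.
Proof.
by move/subnK <-; elim: (_ - _)%N => // k; apply: subv_trans (power_le _).
Qed.

Lemma power_eq0 k : power k = 0%VS -> power k.+1 = 0%VS.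
Proof. by move=> k0; have := power_le k; rewrite k0 subv0 => /eqP. Qed.

(** By induction on [n], [power n] lies in every subspace containing all products of n + 1
    elements bracketed to the left. *)
Lemma nilpotent_power : nilpotent_algebra A -> exists n, power n = 0%VS.
Proof.
move=> [n nil]; exists n; apply/eqP; rewrite -subv0.
have {nil} : forall (x : A) s, size s = n -> foldl (amul A) x s \in 0%VS.
  by move=> x s /nil->; exact: mem0v.
move: 0%VS; elim: n => [|n IH] W HW.
  by apply/subvP => x _; exact: HW x [::] erefl.
apply: prodv_sub => x y xn _; pose f := linfun (applyr (amul A) y).
suff /subvP/(_ x xn) : (power n <= f @^-1: W)%VS by rewrite -memv_preim lfunE.
apply: IH => z s sn; rewrite -memv_preim lfunE /= -foldl_rcons.
by apply: HW; rewrite size_rcons sn.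
Qed.

(** If two consecutive powers coincide, so do all the following ones, but one of them is 0. *)
Lemma dim_power_lt k : nilpotent_algebra A -> power k != 0%VS ->
  (\dim (power k.+1) < \dim (power k))%N.
Proof.
move=> /nilpotent_power[n n0] k0; rewrite ltn_neqAle dimvS ?power_le // andbT.
apply: contra k0 => /eqP eq_dim.
have stable : power k.+1 = power k by apply/eqP; rewrite eqEdim power_le eq_dim /=.
have kn j : power (j + k) = power k.
  by elim: j => [//|j IH]; rewrite addSn -stable /= IH.
by rewrite -(kn n) -subv0 -n0 power_anti ?leq_addr.
Qed.

Lemma memv_power i j x y : assoc_algebra A ->
  x \in power i -> y \in power j -> x ** y \in power (i + j).+1.
Proof.
move=> assoc; elim: j x y => [|j IH] x y xi yj; first by rewrite addn0; exact: memv_amul.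
apply: (prodv_ind_r yj) => u v uj _; rewrite assoc addnS.
by apply: memv_amul; [exact: IH | exact: memvf].
Qed.

End Powers.
Arguments power {F} A k.

(** * Reduction of a nilpotent algebra to a model *)

Lemma isomorphic_of_basis4 (F : fieldType) (A : algebra F) (t : table F 4)
  (x1 x2 x3 x4 : A) :
  \dim {: A} = 4 -> free [:: x1; x2; x3; x4] ->
  (forall i j : 'I_4,
    let e := fam4 x1 x2 x3 x4 in
    let u := fam4 (row4 1 0 0 0) (row4 0 1 0 0) (row4 0 0 1 0) (row4 0 0 0 1) in
    amul A (e i) (e j) = comb e (amul (table_algebra t) (u i) (u j))) ->
  isomorphic A (table_algebra t).
Proof.
move=> dimA fx eM; apply: (@isomorphic_of_basis _ _ _ [tuple x1; x2; x3; x4]) => // i j.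
have famE (k : 'I_4) : [:: x1; x2; x3; x4]`_k = fam4 x1 x2 x3 x4 k
  by case: k => -[|[|[|[|]]]].
have unitE (k : 'I_4) : 'e_k =
    fam4 (row4 1 0 0 0) (row4 0 1 0 0) (row4 0 0 1 0) (row4 0 0 0 1) k :> 'rV[F]_4.
  by case: k => -[|[|[|[|]]]] // lk; apply/rowP => -[[|[|[|[|]]]]] // ?; rewrite !mxE.
rewrite !famE eM !unitE /comb.
by apply: eq_bigr => k _; rewrite famE.
Qed.

Ltac basis_table :=
  move=> [[|[|[|[|//]]]] ?] [[|[|[|[|//]]]] ?]; cbv zeta;
  rewrite /fam4 /nat_of_ord -/(fam4 _ _ _ _) !mulE /product comb_fam4
          !(mulr0, mul0r, mulr1, mul1r, addr0, add0r, subr0, oppr0, scale0r, scale1r).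

Section Classification.
Variables (R : realType) (A : algebra R).
Hypothesis dimA : \dim {: A} = 4.
Hypothesis assocA : assoc_algebra A.
Hypothesis nilA : nilpotent_algebra A.

Lemma dim_add_vline (V : {vspace A}) x : x \notin V -> \dim (<[x]> + V) = (\dim V).+1.
Proof.
move=> xV; rewrite dimv_disjoint_sum.
  by rewrite dim_vline; case: eqVneq xV => // ->; rewrite mem0v.
apply/eqP; rewrite -subv0; apply/subvP => y; rewrite memv_cap => /andP[/vlineP[k ->]].
have [-> | k0] := eqVneq k 0; first by rewrite scale0r !mem0v.
by rewrite rpredZeq (negbTE k0) (negbTE xV).
Qed.

Lemma dim1_vline (V : {vspace A}) x : \dim V = 1 -> x \in V -> x != 0 -> V = <[x]>%VS.
Proof.
move=> dV xV x0; apply/esym/eqP; rewrite eqEdim dim_vline x0 dV leqnn andbT.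
by rewrite -memvE.
Qed.

(** For [x] outside A^2 the whole algebra is the line of [x] plus A^2; multiplying, A^k is
    the line of x^k plus A^(k+1). As A^5 = 0 for reasons of dimension, the powers x, x^2,
    x^3, x^4 generate the algebra. *)
Lemma classified_monogenic : \dim (power A 1) = 3 -> classified A.
Proof.
move=> d1.
have decr k : (\dim (power A k.+1) <= (\dim (power A k)).-1)%N.
  have [k0 | k0] := eqVneq (power A k) 0%VS; last first.
    by have := dim_power_lt nilA k0; case: (\dim (power A k)).
  by rewrite (power_eq0 k0) dimv0.
have p4 : power A 4 = 0%VS.
  apply/eqP; rewrite -dimv_eq0 -leqn0.
  move: (decr 3) (decr 2) (decr 1); rewrite d1.
  by case: (\dim (power A 2)) => [|[|[|?]]] //; case: (\dim (power A 3)) => [|[|?]].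
have [x xA1] : exists x, x \notin power A 1.
  have : ~~ (fullv <= power A 1)%VS.
    by apply/negP => /dimvS; rewrite dimA d1.
  by move/subvPn=> [x _ xA1]; exists x.
pose f k := iter k (fun y => y ** x) x.
have fP k : f k \in power A k.
  by elim: k => [|k IH]; [exact: memvf | apply: memv_amul; [exact: IH | exact: memvf]].
have full : (fullv <= <[x]> + power A 1)%VS.
  by rewrite -(geq_leqif (dimv_leqif_sup (subvf _))) dimA dim_add_vline ?d1.
have gen k : (power A k <= <[f k]> + power A k.+1)%VS.
  elim: k => [//|k IH]; apply: prodv_sub => y z yk _.
  have /memv_addP[_ /vlineP[s ->] [y' y'k ->]] := subvP IH _ yk.
  have /memv_addP[_ /vlineP[t ->] [z' z'1 ->]] := subvP full _ (memvf z).
  rewrite amulDr amulZr amulDl amulZl scalerDr scalerA -addrA memv_add //.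
    by rewrite memvZ // memv_line.
  apply: memvD.
    by rewrite memvZ // memv_amul ?memvf.
  by have := memv_power assocA (memvD (memvZ s (fP k))
    (subvP (power_le A k) _ y'k)) z'1; rewrite addn1.
have span4 : (fullv <= <<[:: f 0%N; f 1%N; f 2%N; f 3%N]>>)%VS.
  rewrite !span_cons span_nil.
  rewrite -[fullv]/(power A 0).
  apply: subv_trans (gen _) _; apply: addvS; first exact: subvv.
  apply: subv_trans (gen _) _; apply: addvS; first exact: subvv.
  apply: subv_trans (gen _) _; apply: addvS; first exact: subvv.
  by rewrite -p4; exact: gen.
have fr : free [:: f 0%N; f 1%N; f 2%N; f 3%N].
  apply: (@basis_free _ _ fullv); rewrite basisEdim span4 dimA //.
have f4 i j : (3 <= i + j)%N -> f i ** f j = 0.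
  move=> ij; apply/eqP; rewrite -memv0 -p4.
  have le4 := @power_anti _ A 4 (i + j).+1 ij.
  exact: subvP le4 _ (memv_power assocA (fP i) (fP j)).
exists A4_15 => //.
apply: (isomorphic_of_basis4 dimA fr).
have f11 : f 1%N ** f 1%N = f 3%N by rewrite /f /= -!assocA.
have fx k : f 0%N ** f k = f k.+1.
  by elim: k => // k IH; rewrite [f k.+1]/(f k ** x) assocA IH.
have xf k : f k ** f 0%N = f k.+1 by [].
by basis_table; first [exact: f4 | rewrite ?fx ?xf ?f11].
Qed.

(** The completing vector may still be corrected by multiples of the first two vectors. *)
Lemma free3_extend (x y z : A) : free [:: x; y; z] ->
  exists u, forall s t, free [:: x; y; u - s *: x - t *: y; z].
Proof.
move=> fr; have : ~~ (fullv <= <<[:: x; y; z]>>)%VS.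
  by apply/negP => /dimvS; rewrite dimA (eqP fr).
move/subvPn=> [u _ uN]; exists u => s t.
rewrite (perm_free (_ : perm_eq _ [:: u - s *: x - t *: y; x; y; z])); last first.
  exact: permEl (perm_catCA [:: x; y] [:: u - s *: x - t *: y] [:: z]).
rewrite free_cons fr andbT; apply: contra uN => uxyz.
have -> : u = (u - s *: x - t *: y) + s *: x + t *: y.
  by rewrite addrAC subrK subrK.
by apply: memvD; [apply: memvD; [exact: uxyz | apply: memvZ] | apply: memvZ];
  rewrite memv_span // !inE eqxx ?orbT.
Qed.

(** The quotients A^2 / A^3 and A^3 are lines. If (xy)z <> 0, then (xy)z = x(yz) shows that
    yz is outside A^3, hence a multiple of xy modulo A^3, so that (yz)z = y(zz) <> 0; the
    same argument then gives (zz)z <> 0. With q = z^2 and d = z^3, a basis is completed by a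
    vector [w] with wq = 0 and wz = 0; associativity puts zw and ww in the line of [d]. *)
Lemma classified_cube_nonzero :
  power A 2 != 0%VS -> \dim (power A 1) = 2 -> classified A.
Proof.
move=> p2 d1.
have p1 : power A 1 != 0%VS by rewrite -dimv_eq0 d1.
have d2 : \dim (power A 2) = 1.
  have := dim_power_lt nilA p1; rewrite d1.
  by move: p2; rewrite -dimv_eq0; case: (\dim _) => [|[|]].
have p3 : power A 3 = 0%VS.
  have /(dim_power_lt nilA) := p2.
  by rewrite d2 ltnS leqn0 dimv_eq0 => /eqP.
have mul0 i j x y : x \in power A i -> y \in power A j -> (2 <= i + j)%N -> x ** y = 0.
  move=> xi yj ij; apply/eqP; rewrite -memv0 -p3.
  have le3 := @power_anti _ A 3 (i + j).+1 ij.
  exact: subvP le3 _ (memv_power assocA xi yj).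
have inF x : x \in power A 0 := memvf x.
have in1 x y : x ** y \in power A 1 by exact: (memv_power assocA (inF x) (inF y)).
have gen u v : u \in power A 1 -> u \notin power A 2 -> v \in power A 1 ->
    exists s w, w \in power A 2 /\ v = s *: u + w.
  move=> u1 u2 v1.
  suff /subvP/(_ v v1)/memv_addP[_ /vlineP[s ->] [w w2 ->]] :
    (power A 1 <= <[u]> + power A 2)%VS by exists s, w.
  have le : (<[u]> + power A 2 <= power A 1)%VS by rewrite subv_add -memvE u1 power_le.
  by rewrite -(geq_leqif (dimv_leqif_sup le)) d1 dim_add_vline ?d2.
have [x [y [z xyz]]] : exists x y z : A, (x ** y) ** z != 0.
  apply: contrapT => none; case/negP: p2; rewrite -subv0.
  apply: prodv_sub => x y x1 _; apply: (prodv_ind_l x1) => u v _ _.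
  by rewrite memv0; apply/negP => /negP uvy; apply: none; exists u, v, y.
have ann2 u v : u \in power A 2 -> u ** v = 0 /\ v ** u = 0.
  by move=> u2; rewrite !(@mul0 2 0 u v, @mul0 0 2 v u).
have [xy2 yz2] : x ** y \notin power A 2 /\ y ** z \notin power A 2.
  split; apply: contraNN xyz => /ann2 H; first by rewrite (H z).1.
  by rewrite -assocA (H x).2.
have step v : v \in power A 1 -> v \notin power A 2 -> v ** z != 0.
  move=> v1 v2; have [s [w [w2 xyE]]] := gen v (x ** y) v1 v2 (in1 _ _).
  by apply: contra_neq xyz => vz;
    rewrite xyE amulDl amulZl vz (ann2 w z w2).1 scaler0 addr0.
have zz2 : z ** z \notin power A 2.
  have := step _ (in1 y z) yz2; apply: contraNN => /ann2 H.
  by rewrite -assocA (H y).2.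
have zzz : (z ** z) ** z != 0 := step _ (in1 z z) zz2.
move: zz2 zzz; set q := z ** z; set d := q ** z => q2 d0.
have d2P : d \in power A 2 by exact: (memv_power assocA (in1 z z) (inF z)).
have p2E : power A 2 = <[d]>%VS by exact: dim1_vline.
have in2 u v : u \in power A 1 -> exists2 k, u ** v = k *: d & exists l, v ** u = l *: d.
  move=> u1; have /vlineP[k ->] : u ** v \in <[d]>%VS.
    by rewrite -p2E; exact: (memv_power assocA u1 (inF v)).
  have /vlineP[l ->] : v ** u \in <[d]>%VS.
    by rewrite -p2E; exact: (memv_power assocA (inF v) u1).
  by exists k => //; exists l.
have in1E v : v \in power A 1 -> exists k l, v = k *: q + l *: d.
  move=> /(gen q v (in1 z z) q2) [k [w [w2 ->]]]; exists k.
  by move: w2; rewrite p2E => /vlineP[l ->]; exists l.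
have z1 : z \notin power A 1.
  by apply: contra q2 => z1; rewrite /q (mul0 1 1) ?mem0v.
have fr : free [:: z; q; d].
  rewrite !free_cons span_cons !span_seq1 span_nil nil_free memv0 d0 -p2E !andbT q2 andbT.
  apply: contra z1; apply/subvP.
  by rewrite subv_add -memvE (in1 z z) power_le.
have [u fru] := free3_extend fr.
have zq : z ** q = d by rewrite /d /q assocA.
have [g uq] : exists g, u ** q = g *: d.
  by have [_ _ [g uq]] := in2 q u (in1 z z); exists g.
pose v := u - g *: z; have vq : v ** q = 0.
  by rewrite /v amulBl amulZl zq uq subrr.
have [k1 [l1 vz]] := in1E _ (in1 v z).
have [k2 [l2 zv]] := in1E _ (in1 z v).
have [k3 [l3 vv]] := in1E _ (in1 v v).
have dA y' : d ** y' = 0 by rewrite (ann2 d y' d2P).1.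
have Ad y' : y' ** d = 0 by rewrite (ann2 d y' d2P).2.
have qq : q ** q = 0 by apply: (mul0 1 1); rewrite ?in1.
have scal k : k *: d = 0 -> k = 0.
  by move/eqP; rewrite scaler_eq0 (negbTE d0) orbF => /eqP.
(* Associativity removes the components along [q] of vz, zv and vv. *)
have k10 : k1 = 0.
  apply: scal; have := assocA v z z;
    rewrite -/q vq vz amulDl !amulZl dA scaler0 addr0 -/d.
  by move=> <-.
have k20 : k2 = 0.
  apply: scal; have := assocA z v z.
  rewrite vz zv k10 scale0r add0r amulZr Ad scaler0 amulDl !amulZl dA scaler0 addr0 -/d.
  by move=> <-.
have k30 : k3 = 0.
  apply: scal; have := assocA v v z.
  rewrite vz vv k10 scale0r add0r amulZr Ad scaler0 amulDl !amulZl dA scaler0 addr0 -/d.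
  by move=> <-.
have qv : q ** v = 0.
  by rewrite /q -assocA zv k20 scale0r add0r amulZr Ad scaler0.
move: vz zv vv; rewrite k10 k20 k30 !scale0r !add0r => vz zv vv.
pose w := v - l1 *: q.
have wz : w ** z = 0 by rewrite /w amulBl amulZl vz subrr.
have zw : z ** w = (l2 - l1) *: d by rewrite /w amulBr amulZr zv zq scalerBl.
have wq : w ** q = 0 by rewrite /w amulBl amulZl vq qq scaler0 subr0.
have qw : q ** w = 0 by rewrite /w amulBr amulZr qv qq scaler0 subr0.
have ww : w ** w = l3 *: d.
  by rewrite {1}/w amulBl amulZl qw scaler0 subr0 /w amulBr amulZr vv vq scaler0 subr0.
apply: classified_isomorphic (classified_cubic (l2 - l1) l3).
apply: (isomorphic_of_basis4 dimA (fru g l1)); rewrite -/v -/w.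
by basis_table; rewrite ?dA ?Ad.
Qed.

Lemma free_extend (V : {vspace A}) : exists s : seq A,
  size s = (4 - \dim V)%N /\ free (s ++ vbasis V).
Proof.
exists (vbasis V^C); split; first by rewrite size_tuple dimv_compl dimA.
have /cat_basis : directv (V^C + V)%VS.
  by rewrite directv_addE !directv_trivial /= capvC capv_compl.
by move/(_ _ _ (vbasisP _) (vbasisP _)); exact: basis_free.
Qed.

Lemma classified_cube_zero :
  power A 2 = 0%VS -> (\dim (power A 1) <= 2)%N -> classified A.
Proof.
move=> p2 d1.
have in1 x y : x ** y \in power A 1 by exact: memv_amul (memvf x) (memvf y).
have ann x y : x \in power A 1 -> x ** y = 0 /\ y ** x = 0.
  move=> x1; split; apply/eqP; rewrite -memv0 -p2.
    exact: (memv_power assocA x1 (memvf y : y \in power A 0)).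
  exact: (memv_power assocA (memvf y : y \in power A 0) x1).
move: d1; rewrite leq_eqVlt => /predU1P[d1 | d1].
  have [s [ss fr]] := free_extend (power A 1); rewrite d1 in ss.
  case: s ss fr => [|x [|y [|]]] //= _.
  have wP := vbasisP (power A 1); move: (vbasis (power A 1)) wP; rewrite d1.
  case/tupleP=> w1 t; case/tupleP: t => w2 t; rewrite tuple0 /= => wP fr.
  have w1P : w1 \in power A 1 by apply: (basis_mem wP); rewrite inE eqxx.
  have w2P : w2 \in power A 1 by apply: (basis_mem wP); rewrite !inE eqxx orbT.
  have coef u v : exists m n, u ** v = m *: w1 + n *: w2.
    have : u ** v \in <<[:: w1; w2]>>%VS by rewrite (span_basis wP); exact: in1.
    rewrite span_cons span_seq1.
    by case/memv_addP=> _ /vlineP[m ->] [_ /vlineP[n ->] ->]; exists m, n.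
  have [m11 [n11 xx]] := coef x x; have [m12 [n12 xy]] := coef x y.
  have [m21 [n21 yx]] := coef y x; have [m22 [n22 yy]] := coef y y.
  apply: classified_isomorphic (classified_form2 m11 m12 m21 m22 n11 n12 n21 n22).
  apply: (isomorphic_of_basis4 dimA fr).
  by basis_table; first [done | exact: (ann w1 _ w1P).1 | exact: (ann w1 _ w1P).2
    | exact: (ann w2 _ w2P).1 | exact: (ann w2 _ w2P).2].
(* A line containing A^2 and annihilating A, also when A^2 = 0. *)
have [W [dW W1 annW]] : exists W : {vspace A},
    [/\ \dim W = 1, (power A 1 <= W)%VS & forall x y,
      x \in W -> x ** y = 0 /\ y ** x = 0].
  have [p10 | p10] := eqVneq (power A 1) 0%VS; last first.
    exists (power A 1); split => //.
    by move: d1 p10; rewrite -dimv_eq0; case: (\dim _) => [|[|]].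
  have f0 : vpick {: A} != 0 by rewrite vpick0 -dimv_eq0 dimA.
  exists <[vpick {: A}]>%VS; rewrite dim_vline f0 p10 sub0v; split=> // x y _.
  by split; apply/eqP; rewrite -memv0 -p10.
have [s [ss fr]] := free_extend W; rewrite dW in ss.
case: s ss fr => [|x [|y [|z [|]]]] //= _.
have wP := vbasisP W; move: (vbasis W) wP; rewrite dW.
case/tupleP=> w t; rewrite tuple0 /= => wP fr.
have wW : w \in W by apply: (basis_mem wP); rewrite inE eqxx.
have coef u v : exists m, u ** v = m *: w.
  have : u ** v \in <<[:: w]>>%VS.
    by rewrite (span_basis wP); exact: subvP W1 _ (in1 u v).
  rewrite span_seq1.
  by case/vlineP=> m ->; exists m.
have [m11 xx] := coef x x; have [m12 xy] := coef x y; have [m13 xz] := coef x z.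
have [m21 yx] := coef y x; have [m22 yy] := coef y y; have [m23 yz] := coef y z.
have [m31 zx] := coef z x; have [m32 zy] := coef z y; have [m33 zz] := coef z z.
apply: classified_isomorphic (classified_form1 m11 m12 m13 m21 m22 m23 m31 m32 m33).
apply: (isomorphic_of_basis4 dimA fr).
by basis_table; first [done | exact: (annW w _ wW).1 | exact: (annW w _ wW).2].
Qed.

Lemma classified_nilpotent : classified A.
Proof.
have d1 : (\dim (power A 1) < 4)%N.
  have := @dim_power_lt _ _ 0 nilA; rewrite [power A 0]/fullv dimA; apply.
  by rewrite -dimv_eq0 dimA.
have [d3 | d3] := eqVneq (\dim (power A 1)) 3; first exact: classified_monogenic.
have d2 : (\dim (power A 1) <= 2)%N by rewrite leq_eqVlt ltnS in d1; lia.
have [p2 | p2] := eqVneq (power A 2) 0%VS; first exact: classified_cube_zero.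
apply: classified_cube_nonzero => //; apply/eqP; rewrite eqn_leq d2.
have p1 : power A 1 != 0%VS by apply: contra_neq p2 => /power_eq0.
have := dim_power_lt nilA p1; move: p2; rewrite -dimv_eq0.
by case: (\dim (power A 2)) => // n _; case: (\dim _) => [|[|]].
Qed.

End Classification.

(** * Isomorphism invariants *)

Section Invariants.
Variable R : realType.
Implicit Types A B : algebra R.

Definition central A (v : A) := forall y, v ** y = y ** v.
(** For a form with values in a line, this is the orthogonal of the kernel of the skew
    part. *)
Definition orthogonal_to_center A (x : A) := forall v : A, central v -> v ** x = 0.

Definition zero_mul A := forall x y : A, x ** y = 0.
Definition cube_zero A := forall x y z : A, (x ** y) ** z = 0.
Definition fourth_zero A := forall x y z t : A, ((x ** y) ** z) ** t = 0.
Definition commutes A := forall x y : A, x ** y = y ** x.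
Definition products_on_line A := exists w : A, forall x y : A, exists s, x ** y = s *: w.
Definition ann_sq_null A := forall x : A, (forall y z, x ** (y ** z) = 0) -> x ** x = 0.
Definition semidefinite A := forall x : A, x ** x = 0 -> forall y, x ** y + y ** x = 0.
Definition orthogonal_pair A := exists x y : A,
  [/\ x ** y = 0, x ** x <> 0 & y ** y <> 0].
Definition orthogonal_triple A := exists x y z : A,
  [/\ x ** y = 0, x ** z = 0 & y ** z = 0] /\ [/\ x ** x <> 0, y ** y <> 0 & z ** z <> 0].
Definition center_orthogonal_sq_null A := forall x : A,
  orthogonal_to_center x -> x ** x = 0.
Definition central_sq A := exists2 v : A, central v & v ** v <> 0.
Definition central_ann A := forall v x : A, central v -> v ** x = 0.
Definition zero_divisors A := exists x y z t : A,
  [/\ x ** y = 0, x ** z <> 0 & y ** t <> 0].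
Definition sq_null A := exists x y : A, x ** x = 0 /\ (x ** y <> 0 \/ y ** x <> 0).
Definition sq_null_ratio (s t : R) A :=
  forall x y : A, x ** x = 0 -> s *: (x ** y) = t *: (y ** x).
Definition sq_null_orth A := forall x y : A, x ** x = 0 -> y ** y = 0 -> x ** y = 0.

Definition is_trace A (m : {scalar A}) := forall x y : A, m (x ** y) = m (y ** x).
(** A functional [l] defines the bilinear form l(xy). For l = m this is twice the
    determinant of the form on x, y, and in general it is the polarisation of this quadratic
    expression in [l]. *)
Definition mixed_det A (l m : {scalar A}) (x y : A) :=
  l (x ** x) * m (y ** y) + m (x ** x) * l (y ** y)
  - l (x ** y) * m (y ** x) - m (x ** y) * l (y ** x).
(** The functionals of [is_trace] are those that define symmetric forms; the property says
    that these forms are semidefinite (e = 1) or have no definite plane (e = -1). *)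
Definition trace_sign (e : R) A := forall m : {scalar A}, is_trace m -> forall x y,
  0 <= e * mixed_det m m x y.
(** Both sides are multiplied by the square of the determinant when x, y undergo a change of
    basis of their plane, and by the square of a factor of [l]; so the equation only depends
    on the plane and on the line of [l]. *)
Definition gram_ratio_on A (W : A -> Prop) (l : {scalar A}) (k : R) :=
  forall x y : A, W x -> W y ->
  mixed_det l l x y = 2 * k * (l (x ** y) - l (y ** x)) ^+ 2.
(** Recovers the parameter of [A4_4] and [A4_9]. *)
Definition form_ratio (k : R) A :=
  forall l : {scalar A}, gram_ratio_on (@orthogonal_to_center A) l k.
(** Recovers the parameter of [A4_25]: in a pencil with one symmetric form, given by [m],
    the forms orthogonal to it, given by [l], are unique up to a factor if it is
    nondegenerate. *)
Definition pencil_ratio (k : R) A := forall l m : {scalar A},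
  is_trace m -> (exists x y, m (x ** y) <> 0) -> (forall x y, mixed_det l m x y = 0) ->
  gram_ratio_on (fun _ => True) l k.

Variables A B : algebra R.
Hypothesis isoAB : isomorphic A B.

Lemma isomorphism_onto : exists f : {linear A -> B},
  [/\ forall x, f x = 0 -> x = 0, forall y, exists x, y = f x
    & forall x y, f (x ** y) = f x ** f y].
Proof.
have [f [[g fK gK] fM]] := isoAB; exists f; split=> // [x fx | y].
  by rewrite -[x]fK fx -(linear0 f) fK.
by exists (g y); rewrite gK.
Qed.

Ltac onto f f0 fS fM := have [f [f0 fS fM]] := isomorphism_onto.

Lemma iso_zero_mul : zero_mul A -> zero_mul B.
Proof.
onto f f0 fS fM => H x y; have [{}x ->] := fS x; have [{}y ->] := fS y.
by rewrite -fM H linear0.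
Qed.

Lemma iso_cube_zero : cube_zero A -> cube_zero B.
Proof.
onto f f0 fS fM => H x y z.
have [{}x ->] := fS x; have [{}y ->] := fS y; have [{}z ->] := fS z.
by rewrite -!fM H linear0.
Qed.

Lemma iso_fourth_zero : fourth_zero A -> fourth_zero B.
Proof.
onto f f0 fS fM => H x y z t; have [{}x ->] := fS x; have [{}y ->] := fS y.
by have [{}z ->] := fS z; have [{}t ->] := fS t; rewrite -!fM H linear0.
Qed.

Lemma iso_commutes : commutes A -> commutes B.
Proof.
onto f f0 fS fM => H x y; have [{}x ->] := fS x; have [{}y ->] := fS y.
by rewrite -!fM H.
Qed.

Lemma iso_products_on_line : products_on_line A -> products_on_line B.
Proof.
onto f f0 fS fM => -[w H]; exists (f w) => x y.
have [{}x ->] := fS x; have [{}y ->] := fS y.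
by have [s xy] := H x y; exists s; rewrite -fM xy linearZ.
Qed.

Lemma iso_ann_sq_null : ann_sq_null A -> ann_sq_null B.
Proof.
onto f f0 fS fM => H x Hx; have [u xu] := fS x; move: Hx; rewrite {x}xu => Hx.
by rewrite -fM H ?linear0 // => y z; apply: f0; rewrite !fM.
Qed.

Lemma iso_semidefinite : semidefinite A -> semidefinite B.
Proof.
onto f f0 fS fM => H x xx y; have [u xu] := fS x; move: xx; rewrite {x}xu.
have [{}y ->] := fS y; rewrite -!fM -linearD => /f0 uu.
by rewrite H // linear0.
Qed.

Lemma iso_orthogonal_pair : orthogonal_pair A -> orthogonal_pair B.
Proof.
onto f f0 fS fM => -[x [y [xy xx yy]]]; exists (f x), (f y).
by rewrite -!fM xy linear0; split=> // /f0.
Qed.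

Lemma iso_orthogonal_triple : orthogonal_triple A -> orthogonal_triple B.
Proof.
onto f f0 fS fM => -[x [y [z [[xy xz yz] [xx yy zz]]]]].
exists (f x), (f y), (f z).
by rewrite -!fM xy xz yz linear0; split=> //; split=> /f0.
Qed.

Lemma iso_central (f : {linear A -> B}) v :
  (forall x, f x = 0 -> x = 0) -> (forall y, exists x, y = f x) ->
  (forall x y, f (x ** y) = f x ** f y) -> central (f v) <-> central v.
Proof.
move=> f0 fS fM; split=> cv y.
  apply/eqP; rewrite -subr_eq0; apply/eqP/f0.
  by rewrite linearB /= !fM cv subrr.
by have [x ->] := fS y; rewrite -!fM cv.
Qed.

Lemma iso_orthogonal_to_center (f : {linear A -> B}) x :
  (forall x, f x = 0 -> x = 0) -> (forall y, exists x, y = f x) ->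
  (forall x y, f (x ** y) = f x ** f y) ->
  orthogonal_to_center (f x) <-> orthogonal_to_center x.
Proof.
move=> f0 fS fM; split=> kx v cv.
  by apply: (f0); rewrite fM kx //; apply/(iso_central v f0 fS fM).
have [u vu] := fS v; move: cv; rewrite {v}vu => /(iso_central u f0 fS fM) cu.
by rewrite -fM kx ?linear0 //.
Qed.

Lemma iso_center_orthogonal_sq_null : center_orthogonal_sq_null A ->
  center_orthogonal_sq_null B.
Proof.
onto f f0 fS fM => H x; have [u ->] := fS x => /(iso_orthogonal_to_center u f0 fS fM) ku.
by rewrite -fM H ?linear0 //.
Qed.

Lemma iso_central_sq : central_sq A -> central_sq B.
Proof.
onto f f0 fS fM => -[v cv vv]; exists (f v); first exact/(iso_central v f0 fS fM).
by rewrite -fM => /f0.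
Qed.

Lemma iso_central_ann : central_ann A -> central_ann B.
Proof.
onto f f0 fS fM => H v x; have [u ->] := fS v; have [{}x ->] := fS x.
by move=> /(iso_central u f0 fS fM) cu; rewrite -fM H ?linear0 //.
Qed.

Lemma iso_zero_divisors : zero_divisors A -> zero_divisors B.
Proof.
onto f f0 fS fM => -[x [y [z [t [xy xz yt]]]]].
exists (f x), (f y), (f z), (f t).
by rewrite -!fM xy linear0; split=> // /f0.
Qed.

Lemma iso_sq_null : sq_null A -> sq_null B.
Proof.
onto f f0 fS fM => -[x [y [xx xy]]]; exists (f x), (f y).
by rewrite -!fM xx linear0; split=> //; case: xy => H; [left|right] => /f0.
Qed.

Lemma iso_sq_null_ratio s t : sq_null_ratio s t A -> sq_null_ratio s t B.
Proof.
onto f f0 fS fM => H x y; have [u ->] := fS x; have [{}y ->] := fS y.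
by rewrite -!fM => /f0 /H-/(_ y)/(congr1 f); rewrite !linearZ.
Qed.

Lemma iso_sq_null_orth : sq_null_orth A -> sq_null_orth B.
Proof.
onto f f0 fS fM => H x y; have [u ->] := fS x; have [v ->] := fS y.
by rewrite -!fM => /f0 uu /f0 vv; rewrite H ?linear0.
Qed.

Lemma iso_trace_sign e : trace_sign e A -> trace_sign e B.
Proof.
onto f f0 fS fM => H m tm x y; have [{}x ->] := fS x; have [{}y ->] := fS y.
have := H (m \o f) _ x y; rewrite /mixed_det /= !fM; apply.
by move=> u v /=; rewrite !fM tm.
Qed.

Lemma iso_form_ratio k : form_ratio k A -> form_ratio k B.
Proof.
onto f f0 fS fM => H l x y; have [u ->] := fS x; have [v ->] := fS y.
move=> /(iso_orthogonal_to_center u f0 fS fM) ku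
  /(iso_orthogonal_to_center v f0 fS fM) kv.
by have := H (l \o f) u v; rewrite /mixed_det /= !fM; apply.
Qed.

Lemma iso_pencil_ratio k : pencil_ratio k A -> pencil_ratio k B.
Proof.
onto f f0 fS fM => H l m tm [x [y mxy]] lm z t _ _.
have [u ->] := fS z; have [v ->] := fS t.
have := H (l \o f) (m \o f) _ _ _ u v I I; rewrite /mixed_det /= !fM; apply.
- by move=> p q /=; rewrite !fM tm.
- by have [p xE] := fS x; have [q yE] := fS y; exists p, q; rewrite /= fM -xE -yE.
- by move=> p q; have := lm (f p) (f q); rewrite /mixed_det /= !fM.
Qed.

End Invariants.

(** * Values of the invariants on the list *)

Ltac coords := repeat (let x1 := fresh "x1" in let x2 := fresh "x2" in
  let x3 := fresh "x3" in let x4 := fresh "x4" in elim/row4_ind=> x1 x2 x3 x4).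
Ltac mul := do ?rewrite amul_row4 /product.

Section Evaluation.
Variable R : realType.
Implicit Types N : name R.

Let ea : 'rV[R]_4 := row4 1 0 0 0.
Let eb : 'rV[R]_4 := row4 0 1 0 0.
Let ec : 'rV[R]_4 := row4 0 0 1 0.

(** The stage is 0 if A^2 = 0, is dim A^2 if A^3 = 0, and is 3 if A^3 <> 0. *)
Definition stage N : nat :=
  match N with
  | A4_1 => 0
  | A4_16 | A4_18 _ | A4_20 | A4_21 _ | A4_23 _ | A4_24 | A4_25 _ _ _ => 2
  | A4_6 | A4_12 | A4_13 | A4_14 | A4_15 => 3
  | _ => 1
  end.

Lemma zero_mul_stage N : zero_mul (algebra_of N) <-> stage N = 0.
Proof.
split; last first.
  by case: N => //= _; coords; coords; mul; rewrite row40.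
move=> H; move: (H ea ea) (H ea eb) (H eb eb); rewrite /ea /eb {H}.
(* The pattern follows the constructors of [name] and names their parameters. *)
case: N => [ | |k|k| | | |k l|k l|k| | | | | | |k| |k|k| |k l m] //; mul; rewrite row40;
by move=> /row4P[? ? ? ?] /row4P[? ? ? ?] /row4P[? ? ? ?]; exfalso; lra.
Qed.

Lemma cube_zero_stage N : cube_zero (algebra_of N) <-> (stage N < 3)%N.
Proof.
split; last first.
  case: N => //= *; coords; coords; coords; mul; rewrite row40;
  by apply/row4P; split; ring.
move=> H; move: (H ea ea ea); rewrite /ea {H}.
case: N => [ | |k|k| | | |k l|k l|k| | | | | | |k| |k|k| |k l m] //; mul; rewrite row40;
by move=> /row4P[? ? ? ?]; exfalso; lra.
Qed.

Lemma products_on_line_stage N : (stage N < 3)%N ->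
  products_on_line (algebra_of N) <-> (stage N < 2)%N.
Proof.
move=> N3; split.
  case; elim/row4_ind=> w1 w2 w3 w4 H; move: (H ea ea) (H ea eb) (H eb ea).
  rewrite /ea /eb {H}; case: N N3 =>
    [ | |k|k| | | |k l|k l|k| | | | | | |k| |k|k| |k l m] // _; mul;
  move=> [s1 +] [s2 +] [s3 +]; rewrite !row4Z =>
    /row4P[_ _ e1 e2] /row4P[_ _ e3 e4] /row4P[_ _ e5 e6];
  exfalso; nra.
move=> N2; exists (match N with A4_2 => eb | A4_3 _ | A4_4 _ | A4_5 => ec
                   | _ => row4 0 0 0 1 end).
coords; coords; rewrite /eb /ec;
  case: N N3 N2 => [ | |k|k| | | |k l|k l|k| | | | | | |k| |k|k| |k l m] // _ _; mul;
by eexists; rewrite row4Z; apply/row4P; split; rewrite ?mulr0 ?mulr1; reflexivity.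
Qed.

Lemma commutes_stage3 N : stage N = 3 ->
  commutes (algebra_of N) <->
    ((if N is A4_12 then false else if N is A4_14 then false else true) : bool).
Proof.
move=> N3; split.
  move=> /(_ ea ec); rewrite /ea /ec;
    case: N N3 => [ | |k|k| | | |k l|k l|k| | | | | | |k| |k|k| |k l m] // _; mul.
    by move=> /row4P[? ? ? ?]; exfalso; lra.
  by move=> /row4P[? ? ? ?]; exfalso; lra.
by case: N N3 => [ | |k|k| | | |k l|k l|k| | | | | | |k| |k|k| |k l m] // _ _; coords;
  coords; mul; apply/row4P; split; ring.
Qed.

Lemma fourth_zero_stage3 N : stage N = 3 ->
  fourth_zero (algebra_of N) <-> ((if N is A4_15 then false else true) : bool).
Proof.
move=> N3; split.
  move=> /(_ ea ea ea ea); rewrite /ea;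
    case: N N3 => [ | |k|k| | | |k l|k l|k| | | | | | |k| |k|k| |k l m] // _; mul.
  by rewrite row40 => /row4P[? ? ? ?]; exfalso; lra.
case: N N3 => [ | |k|k| | | |k l|k l|k| | | | | | |k| |k|k| |k l m] // _ _; coords;
  coords; coords; coords; mul;
by rewrite row40; apply/row4P; split; ring.
Qed.

Lemma ann_sq_null_stage3 N : stage N = 3 ->
  ann_sq_null (algebra_of N) <->
    ((if N is A4_12 then false else if N is A4_13 then false else true) : bool).
Proof.
move=> N3; split.
  move=> /(_ ec); case: N N3 => [ | |k|k| | | |k l|k l|k| | | | | | |k| |k|k| |k l m]
    // _ H;
  (refine (_ (H _)); clear H; [ rewrite /ec; mul; rewrite row40 => /row4P[? ? ? ?];
    exfalso; lra
  | coords; coords; rewrite /ec; mul; rewrite row40; apply/row4P; split; ring ]).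
case: N N3 => [ | |k|k| | | |k l|k l|k| | | | | | |k| |k|k| |k l m] // _ _;
  coords => /(_ ea ea); rewrite /ea; mul;
rewrite row40 => /row4P[? ? ? ?]; apply/row4P; split; nra.
Qed.

Definition commutative_name N : bool :=
  match N with
  | A4_2 | A4_3 _ | A4_8 _ _ | A4_23 _ => true
  | A4_21 k => k == 1
  | _ => false
  end.

Lemma commutes_stage12 N : (0 < stage N < 3)%N -> listed N ->
  commutes (algebra_of N) <-> commutative_name N.
Proof.
move=> N12 lN; split.
  move=> H; move: (H ea eb) (H eb ec); rewrite /ea /eb /ec {H}.
  case: N N12 lN => [ | |k|k| | | |k l|k l|k| | | | | | |k| |k|k| |k l m] // _ lN;
    rewrite /commutative_name; mul;
  move=> /row4P[e1 e2 e3 e4] /row4P[e5 e6 e7 e8]; try (exfalso; lra).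
    by apply/eqP; lra.
  by exfalso; case: lN => /andP[]; lra.
case: N N12 lN => [ | |k|k| | | |k l|k l|k| | | | | | |k| |k|k| |k l m] // _ lN;
  rewrite /commutative_name //; first [move/eqP-> | move=> _]; coords; coords; mul;
by apply/row4P; split; ring.
Qed.

Definition comm_stage1 N : bool :=
  match N with A4_2 | A4_3 _ | A4_8 _ _ => true | _ => false end.

Lemma semidefinite_comm N : comm_stage1 N -> listed N ->
  semidefinite (algebra_of N) <->
  (match N with A4_3 k => k == 1 | A4_8 _ l => l == 1 | _ => true end : bool).
Proof.
move=> cN lN; split.
  case: N cN lN => [ | |k|k| | | |k l|k l|k| | | | | | |k| |k|k| |k l m] // _;
    [case=> -> | case=> -> [->|->]]; rewrite ?eqxx //.
    move=> /(_ (row4 1 1 0 0)) H; refine (_ (H _)); clear H.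
      move=> /(_ ea); rewrite /ea; mul; rewrite row4D row40 => /row4P[*]; exfalso; lra.
    by mul; rewrite row40; apply/row4P; split; ring.
  move=> /(_ (row4 1 0 1 0)) H; refine (_ (H _)); clear H.
    move=> /(_ ea); rewrite /ea; mul; rewrite row4D row40 => /row4P[*]; exfalso; lra.
  by mul; rewrite row40; apply/row4P; split; ring.
case: N cN lN => [ | |k|k| | | |k l|k l|k| | | | | | |k| |k|k| |k l m] // _ lN.
- move=> _; coords; mul; rewrite row40 => /row4P[e1 e2 e3 e4]; coords; mul; rewrite row4D.
  have -> : x1 = 0 by nra.
  by apply/row4P; split; ring.
- move=> /eqP->; coords; mul; rewrite row40 => /row4P[e1 e2 e3 e4]; coords; mul;
  rewrite row4D.
  have -> : x1 = 0 by nra.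
  have -> : x2 = 0 by nra.
  by apply/row4P; split; ring.
- case: lN => -> _ /eqP->; coords; mul; rewrite row40 => /row4P[e1 e2 e3 e4]; coords;
  mul; rewrite row4D.
  have -> : x1 = 0 by nra.
  have -> : x2 = 0 by nra.
  have -> : x3 = 0 by nra.
  by apply/row4P; split; ring.
Qed.

Lemma orthogonal_pair_comm N : comm_stage1 N -> listed N ->
  orthogonal_pair (algebra_of N) <-> ((if N is A4_2 then false else true) : bool).
Proof.
move=> cN lN; split.
  case: N cN lN => [ | |k|k| | | |k l|k l|k| | | | | | |k| |k|k| |k l m] // _ _.
  case; elim/row4_ind=> x1 x2 x3 x4 [+]; elim/row4_ind=> y1 y2 y3 y4; mul.
  rewrite row40 => -[/row4P[_ xy _ _]]; move/eqP: xy; rewrite mulf_eq0 => /orP[] /eqP z.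
    by case; rewrite z; apply/row4P; split; ring.
  by move=> _; case; rewrite z; apply/row4P; split; ring.
case: N cN lN => [ | |k|k| | | |k l|k l|k| | | | | | |k| |k|k| |k l m] // _ lN _;
  exists ea, eb; rewrite /ea /eb; mul; rewrite row40.
  split; first (by apply/row4P; split; ring); move=> /row4P[? ? ? ?]; first lra.
  by case: lN => ?; lra.
by case: lN => -> _; split; first (by apply/row4P; split; ring);
  move=> /row4P[? ? ? ?]; lra.
Qed.

(** Three pairwise orthogonal vectors with nonzero squares are independent modulo the
    radical, so they exist only for forms of rank three. *)
Lemma orthogonal_triple_comm N : comm_stage1 N -> listed N ->
  orthogonal_triple (algebra_of N) <-> ((if N is A4_8 _ _ then true else false) : bool).
Proof.
move=> cN lN; split.
  case: N cN lN => [ | |k|k| | | |k l|k l|k| | | | | | |k| |k|k| |k l m] // _ _.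
    case; elim/row4_ind=> x1 x2 x3 x4 [+]; elim/row4_ind=> y1 y2 y3 y4 [z]; mul.
    rewrite row40 => -[[/row4P[_ xy _ _] _ _]].
    move/eqP: xy; rewrite mulf_eq0 => /orP[] /eqP e.
      by case; case; rewrite e; apply/row4P; split; ring.
    by case=> _; case; rewrite e; apply/row4P; split; ring.
  case; elim/row4_ind=> x1 x2 x3 x4 [+]; elim/row4_ind=> y1 y2 y3 y4 [+].
  elim/row4_ind=> z1 z2 z3 z4; mul; rewrite row40.
  move=> -[[/row4P[_ _ xy _] /row4P[_ _ xz _] /row4P[_ _ yz _]]].
  set nx := x1 * x1 + _; set ny := y1 * y1 + _; set nz := z1 * z1 + _ => -[xx yy zz].
  (* The Gram determinant of three vectors of a plane vanishes. *)
  have gram0 : nx * ny * nz = 0.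
    have -> : nx * ny * nz = nx * ny * nz
      + 2 * (x1 * y1 + k * x2 * y2) * (x1 * z1 + k * x2 * z2) * (y1 * z1 + k * y2 * z2)
      - nx * (y1 * z1 + k * y2 * z2) ^+ 2 - ny * (x1 * z1 + k * x2 * z2) ^+ 2
      - nz * (x1 * y1 + k * x2 * y2) ^+ 2 by rewrite xy xz yz; ring.
    by rewrite /nx /ny /nz; ring.
  move/eqP: gram0; rewrite !mulf_eq0 => /orP[/orP[]|] /eqP e; exfalso;
    [apply: xx | apply: yy | apply: zz]; by rewrite e.
case: N cN lN => [ | |k|k| | | |k l|k l|k| | | | | | |k| |k|k| |k l m] // _ [-> l1] _;
  exists ea, eb, ec; rewrite /ea /eb /ec; mul; rewrite row40.
split; first by split; apply/row4P; split; ring.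
by split=> /row4P[? ? ? ?]; try lra; case: l1 => ?; lra.
Qed.

Definition noncomm_stage1 N : bool :=
  match N with A4_4 _ | A4_5 | A4_7 | A4_9 _ _ | A4_10 _ | A4_11 => true | _ => false end.

Lemma central_row4 N v1 v2 v3 v4 : noncomm_stage1 N -> listed N ->
  central (row4 v1 v2 v3 v4 : algebra_of N) <->
  match N with
  | A4_4 _ | A4_5 | A4_10 _ => v1 = 0 /\ v2 = 0
  | A4_11 => v2 = 0 /\ v3 = - v1
  | _ => v2 = 0 /\ v3 = 0
  end.
Proof.
move=> nN lN; split.
  move=> H; move: (H ea) (H eb) (H ec); rewrite /ea /eb /ec {H}.
  case: N nN lN => [ | |k|k| | | |k l|k l|k| | | | | | |k| |k|k| |k l m] // _ lN; mul;
  by move=> /row4P[? ? ? ?] /row4P[? ? ? ?] /row4P[? ? ? ?]; split; lra.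
by case: N nN lN => [ | |k|k| | | |k l|k l|k| | | | | | |k| |k|k| |k l m] // _ lN [->
  ->]; coords; mul; apply/row4P; split; ring.
Qed.

Lemma central_ann_noncomm N : noncomm_stage1 N -> listed N ->
  central_ann (algebra_of N) <->
  (match N with A4_4 _ | A4_5 => true | _ => false end : bool).
Proof.
move=> nN lN; split; last first.
  case: N nN lN => [ | |k|k| | | |k l|k l|k| | | | | | |k| |k|k| |k l m] // nN lN _;
    coords; coords => /central_row4-/(_ nN lN)[-> ->];
  by mul; rewrite row40; apply/row4P; split; ring.
pose v : 'rV[R]_4 := match N with A4_10 _ => ec | A4_11 => row4 1 0 (-1) 0 | _ => ea end.
pose x : 'rV[R]_4 := match N with A4_10 _ => eb | _ => ea end.
move=> /(_ v x); rewrite /v /x /ea /eb /ec => H.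
case: N nN lN @v @x H => [ | |k|k| | | |k l|k l|k| | | | | | |k| |k|k| |k l m] // nN lN
  v x H.
- refine (_ (H _)); clear H; first by mul; rewrite row40 => /row4P[? ? ? ?]; exfalso; lra.
  by apply/central_row4.
- refine (_ (H _)); clear H.
    by mul; rewrite row40 => /row4P[? ? ? ?]; exfalso; case: lN => [?|[? _]]; lra.
  by apply/central_row4.
- refine (_ (H _)); clear H; first by mul; rewrite row40 => /row4P[? ? ? ?]; exfalso; lra.
  by apply/central_row4.
- refine (_ (H _)); clear H; first by mul; rewrite row40 => /row4P[? ? ? ?]; exfalso; lra.
  by apply/central_row4.
Qed.

Lemma central_sq_noncomm N : noncomm_stage1 N -> listed N ->
  central_sq (algebra_of N) <->
  (match N with A4_7 | A4_9 _ _ => true | _ => false end : bool).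
Proof.
move=> nN lN; split.
  case; elim/row4_ind=> v1 v2 v3 v4 /central_row4-/(_ nN lN) H.
  case: N nN lN H => [ | |k|k| | | |k l|k l|k| | | | | | |k| |k|k| |k l m] // nN lN [->
    ->]; mul; case;
  by rewrite row40; apply/row4P; split; ring.
case: N nN lN => [ | |k|k| | | |k l|k l|k| | | | | | |k| |k|k| |k l m] // nN lN _;
  exists ea; rewrite /ea; try (by apply/central_row4);
  mul; rewrite row40 => /row4P[? ? ? ?]; first lra.
by case: lN => [?|[? _]]; lra.
Qed.

Lemma center_orthogonal_sq_null_noncomm N : noncomm_stage1 N -> listed N ->
  center_orthogonal_sq_null (algebra_of N) <->
  (match N with A4_5 | A4_7 | A4_11 => true | _ => false end : bool).
Proof.
move=> nN lN; split.
  pose x : 'rV[R]_4 := match N with A4_9 _ _ => eb | _ => ea end.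
  move=> /(_ x); rewrite /x /ea /eb.
  case: N nN lN @x => [ | |k|k| | | |k l|k l|k| | | | | | |k| |k|k| |k l m] // nN lN x
    H; refine (_ (H _)); clear H;
    try (by mul; rewrite row40 => /row4P[? ? ? ?]; exfalso; lra);
  by coords => /central_row4-/(_ nN lN)[-> ->]; mul; rewrite row40; apply/row4P; split;
    ring.
case: N nN lN => [ | |k|k| | | |k l|k l|k| | | | | | |k| |k|k| |k l m] // nN lN _;
  coords => H.
- by mul; rewrite row40; apply/row4P; split; ring.
- refine (_ (H (row4 1 0 0 0) _)); clear H; last by apply/central_row4.
  mul; rewrite row40 => /row4P[? ? ? ?].
  have -> : x1 = 0 by lra.
  by apply/row4P; split; ring.
- refine (_ (H (row4 1 0 (-1) 0) _)); clear H; last by apply/central_row4.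
  mul; rewrite row40 => /row4P[? ? ? ?].
  have -> : x3 = - x1 by lra.
  by apply/row4P; split; ring.
Qed.

Lemma scalar_row4 N (l : {scalar (algebra_of N)}) : exists p1 p2 p3 p4 : R,
  forall x1 x2 x3 x4, l (row4 x1 x2 x3 x4) = x1 * p1 + x2 * p2 + x3 * p3 + x4 * p4.
Proof.
pose e := fam4 (row4 1 0 0 0) (row4 0 1 0 0) (row4 0 0 1 0)
  (row4 0 0 0 1) : _ -> algebra_of N.
exists (l (e a)), (l (e b)), (l (e c)), (l (e d)) => x1 x2 x3 x4.
have -> : row4 x1 x2 x3 x4 = comb e (row4 x1 x2 x3 x4).
  by rewrite comb_fam4 !row4Z !row4D; apply/row4P; split; ring.
by rewrite comb_fam4 !linearD !linearZ.
Qed.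

Definition functional4 (p1 p2 p3 p4 : R) (x : 'rV[R]_4) : R :=
  x 0 a * p1 + x 0 b * p2 + x 0 c * p3 + x 0 d * p4.

Lemma functional4_linear p1 p2 p3 p4 : scalar (functional4 p1 p2 p3 p4).
Proof. by move=> k x y; rewrite /functional4 !mxE; ring. Qed.
HB.instance Definition _ p1 p2 p3 p4 :=
  GRing.isLinear.Build _ _ _ _ (functional4 p1 p2 p3 p4) (functional4_linear p1 p2 p3 p4).

Lemma functional4_row4 p1 p2 p3 p4 x1 x2 x3 x4 :
  functional4 p1 p2 p3 p4 (row4 x1 x2 x3 x4) = x1 * p1 + x2 * p2 + x3 * p3 + x4 * p4.
Proof. by rewrite /functional4 !mxE. Qed.

Lemma form_ratio_A4_4 (k k' : R) : form_ratio k (algebra_of (A4_4 k')) <-> k = k'.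
Proof.
split=> [H | ->].
  refine (_ (H (functional4 0 0 1 0) ea eb _ _)); clear H.
  - by rewrite /mixed_det /ea /eb; mul; rewrite /= !functional4_row4; lra.
  - by coords => /central_row4-/(_ isT I)[-> ->]; rewrite /ea; mul; rewrite row40;
    apply/row4P; split; ring.
  - by coords => /central_row4-/(_ isT I)[-> ->]; rewrite /eb; mul; rewrite row40;
    apply/row4P; split; ring.
move=> l; have [p1 [p2 [p3 [p4 lE]]]] := scalar_row4 l.
by coords; coords => _ _; rewrite /mixed_det; mul; rewrite !lE; ring.
Qed.

Lemma form_ratio_A4_9 (k e k' : R) : listed (A4_9 e k') ->
  form_ratio k (algebra_of (A4_9 e k')) <-> k = k'.
Proof.
move=> le; split=> [H | ->].
  refine (_ (H (functional4 0 0 0 1) eb ec _ _)); clear H.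
  - by rewrite /mixed_det /eb /ec; mul; rewrite /= !functional4_row4; lra.
  - by coords => /central_row4-/(_ isT le)[-> ->]; rewrite /eb; mul; rewrite row40;
    apply/row4P; split; ring.
  - by coords => /central_row4-/(_ isT le)[-> ->]; rewrite /ec; mul; rewrite row40;
    apply/row4P; split; ring.
have kernel x1 x2 x3 x4 :
    orthogonal_to_center (row4 x1 x2 x3 x4 : algebra_of (A4_9 e k')) -> x1 = 0.
  move=> H; refine (_ (H (row4 1 0 0 0) _)); clear H; last by apply/central_row4.
  mul; rewrite row40 => /row4P[? ? ? ?].
  by case: le => [?|[? _]]; nra.
move=> l; have [p1 [p2 [p3 [p4 lE]]]] := scalar_row4 l.
by coords; coords => /kernel-> /kernel->; rewrite /mixed_det; mul; rewrite !lE; ring.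
Qed.

(** For k >= 1/4 the form on the plane of [b] and [c] is positive semidefinite, so the sign
    [e] of the square of [a] decides whether the whole form is semidefinite. *)
Lemma semidefinite_A4_9 (e k : R) : listed (A4_9 e k) -> 4^-1 <= k ->
  semidefinite (algebra_of (A4_9 e k)) <-> e = 1.
Proof.
move=> le k4; split.
  case: le => // -[-> _] H; refine (_ (H (row4 1 1 0 0) _ ea)); clear H.
    by rewrite /ea; mul; rewrite row4D row40 => /row4P[? ? ? ?]; lra.
  by mul; rewrite row40; apply/row4P; split; ring.
move=> ->; coords; mul; rewrite row40 => /row4P[_ _ _ e4].
have e4' : x1 ^+ 2 + (x2 + x3 / 2) ^+ 2 + (k - 4^-1) * x3 ^+ 2 = 0.
  by rewrite -[RHS]e4; field.
have k0 : 0 <= (k - 4^-1) * x3 ^+ 2 by rewrite mulr_ge0 ?sqr_ge0 ?subr_ge0.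
have s1 := sqr_ge0 x1; have s2 := sqr_ge0 (x2 + x3 / 2).
have x10 : x1 = 0 by apply/eqP; rewrite -sqrf_eq0; apply/eqP; lra.
have x2E : x2 = - (x3 / 2).
  by apply/eqP; rewrite -addr_eq0 -sqrf_eq0; apply/eqP; lra.
have kx : (k - 4^-1) * x3 = 0.
  have /eqP : (k - 4^-1) * x3 ^+ 2 = 0 by lra.
  by rewrite expr2 mulrA mulf_eq0 => /orP[/eqP // | /eqP->]; rewrite mulr0.
elim/row4_ind=> y1 y2 y3 y4; mul; rewrite row4D; apply/row4P; split; try ring.
rewrite x10 x2E; transitivity (2 * ((k - 4^-1) * x3) * y3); last by rewrite kx; ring.
by field.
Qed.

(** The pencils of stage 2 with a common isotropic vector outside A^2. *)
Definition sq_null_name N : bool :=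
  match N with
  | A4_16 | A4_20 | A4_21 _ => true
  | A4_18 k => k != 1
  | _ => false
  end.

Lemma sq_null_stage2 N : stage N = 2 -> listed N ->
  sq_null (algebra_of N) <-> sq_null_name N.
Proof.
move=> N2 lN; split.
  case; elim/row4_ind=> x1 x2 x3 x4 [+]; elim/row4_ind=> y1 y2 y3 y4 [xx xy].
  have nz : x1 = 0 -> x2 = 0 -> False.
    move=> x10 x20; case: N N2 lN xx xy =>
      [ | |k|k| | | |k l|k l|k| | | | | | |k| |k|k| |k l m] // _ _ _; mul;
    by rewrite x10 x20 row40; case; apply; apply/row4P; split; ring.
  case: N N2 lN xx {xy} nz => [ | |k|k| | | |k l|k l|k| | | | | | |k| |k|k| |k l m] //
    _ lN; mul; rewrite row40 => /row4P[_ _ e1 e2] nz;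
    rewrite /sq_null_name.
  - by apply/eqP => k1; apply: nz; rewrite k1 in e1; nra.
  - exfalso; have /eqP : x1 * x2 = 0 by lra.
    rewrite mulf_eq0 => /orP[] /eqP z; rewrite z in e1 nz; apply: nz => //;
      case: lN => kE; rewrite kE in e1; nra.
  - exfalso; have /eqP : x1 * x2 = 0 by lra.
    rewrite mulf_eq0 => /orP[] /eqP z; rewrite z in e1 nz; apply: nz => //; nra.
  - exfalso; case: lN => /andP[k0 k1] lm; have k10 : 1 + k != 0 by rewrite gt_eqF //; lra.
    have /eqP : (1 + k) * (x1 * x2) = 0 by lra.
    rewrite !mulf_eq0 (negbTE k10) /= => /orP[] /eqP z; rewrite z in e1 nz;
      apply: nz => //.
      by case: lm => [[_ [mE|mE]]|[_ mE]]; rewrite mE in e1; nra.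
    by nra.
case: N N2 lN => [ | |k|k| | | |k l|k l|k| | | | | | |k| |k|k| |k l m] // _ lN.
- move=> _; exists eb, ea; rewrite /ea /eb; mul; rewrite row40; split.
    by apply/row4P; split; ring.
  by left=> /row4P[? ? ? ?]; lra.
- rewrite /sq_null_name; case: lN => [->|->|->]; rewrite ?eqxx // => _.
    exists eb, ea; rewrite /ea /eb; mul; rewrite row40; split.
      by apply/row4P; split; ring.
    by left=> /row4P[? ? ? ?]; lra.
  exists (row4 1 1 0 0), ea; rewrite /ea; mul; rewrite row40; split.
    by apply/row4P; split; ring.
  by left=> /row4P[? ? ? ?]; lra.
- move=> _; exists eb, ea; rewrite /ea /eb; mul; rewrite row40; split.
    by apply/row4P; split; ring.
  by left=> /row4P[? ? ? ?]; lra.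
- move=> _; exists eb, ea; rewrite /ea /eb; mul; rewrite row40; split.
    by apply/row4P; split; ring.
  by right=> /row4P[? ? ? ?]; lra.
Qed.

(** Modulo A^2, the products of [A4_23] are the multiplication of complex numbers for k = 1
    and of pairs of real numbers for k = -1. *)
Lemma zero_divisors_A4_23 (k : R) : k = 1 \/ k = -1 ->
  zero_divisors (algebra_of (A4_23 k)) <-> k = -1.
Proof.
move=> k1; split; last first.
  move=> ->; exists (row4 1 1 0 0), (row4 1 (-1) 0 0), ea, ea.
  rewrite /ea; mul; rewrite row40; split; first by apply/row4P; split; ring.
    by move=> /row4P[? ? ? ?]; lra.
  by move=> /row4P[? ? ? ?]; lra.
case: k1 => -> //; case; elim/row4_ind=> x1 x2 x3 x4 [+]; elim/row4_ind=> y1 y2 y3 y4 [+].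
elim/row4_ind=> z1 z2 z3 z4 [+]; elim/row4_ind=> t1 t2 t3 t4; mul; rewrite row40.
case=> /row4P[_ _ e1 e2] xz yt; exfalso.
(* The norm of complex numbers is multiplicative. *)
have /eqP : (x1 ^+ 2 + x2 ^+ 2) * (y1 ^+ 2 + y2 ^+ 2) = 0.
  transitivity ((x1 * y1 - 1 * x2 * y2) ^+ 2 + (x1 * y2 + x2 * y1) ^+ 2); first by ring.
  by rewrite e1 e2; ring.
have norm0 (u v : R) : u ^+ 2 + v ^+ 2 == 0 -> u = 0 /\ v = 0.
  by rewrite paddr_eq0 ?sqr_ge0 // !sqrf_eq0 => /andP[/eqP-> /eqP->].
rewrite mulf_eq0 => /orP[] /norm0[p q]; [apply: xz | apply: yt];
by rewrite p q; apply/row4P; split; ring.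
Qed.

Lemma sq_null_orth_stage2 N : stage N = 2 -> listed N -> sq_null_name N ->
  sq_null_orth (algebra_of N) <-> ((if N is A4_18 k then k == 0 else true) : bool).
Proof.
move=> N2 lN sN; split.
  case: N N2 lN sN => [ | |k|k| | | |k l|k l|k| | | | | | |k| |k|k| |k l m] // _
    [->|->|->]; rewrite /sq_null_name ?eqxx // => _ H.
  refine (_ (H (row4 1 1 0 0) (row4 1 (-1) 0 0) _ _)); clear H.
  - by mul; rewrite row40 => /row4P[? ? ? ?]; exfalso; lra.
  - by mul; rewrite row40; apply/row4P; split; ring.
  - by mul; rewrite row40; apply/row4P; split; ring.
case: N N2 lN sN => [ | |k|k| | | |k l|k l|k| | | | | | |k| |k|k| |k l m] // _ lN sN;
  try (move/eqP=> kE);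
elim/row4_ind=> x1 x2 x3 x4; elim/row4_ind=> y1 y2 y3 y4; mul; rewrite ?kE row40;
move=> /row4P[_ _ e1 e2] /row4P[_ _ e3 e4];
have x10 : x1 = 0 by nra.
all: have y10 : y1 = 0 by nra.
all: by rewrite x10 y10; apply/row4P; split; ring.
Qed.

(** The linear relations s xy = t yx valid for all x with xx = 0; they separate [A4_16] and
    the parameters of [A4_21]. *)
Definition ratio_condition N (s t : R) : Prop :=
  match N with
  | A4_16 => s = 0
  | A4_18 _ => t = - s
  | A4_21 k => t = s * k
  | _ => s = 0 /\ t = 0
  end.

Lemma sq_null_ratio_stage2 N (s t : R) : (if N is A4_18 k then k == 0 else true) ->
  stage N = 2 -> listed N -> sq_null_name N ->
  sq_null_ratio s t (algebra_of N) <-> ratio_condition N s t.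
Proof.
rewrite /ratio_condition => oN N2 lN sN; split.
  move=> /(_ eb ea); rewrite /ea /eb.
  case: N N2 lN sN oN => [ | |k|k| | | |k l|k l|k| | | | | | |k| |k|k| |k l m] // _ lN
    sN oN H; refine (_ (H _)); clear H;
  try (by mul; rewrite row40; apply/row4P; split; rewrite ?(eqP oN); ring);
  by mul; rewrite !row4Z => /row4P[? ? ? ?]; try split; lra.
case: N N2 lN sN oN => [ | |k|k| | | |k l|k l|k| | | | | | |k| |k|k| |k l m] // _ lN sN
  oN H;
elim/row4_ind=> x1 x2 x3 x4; elim/row4_ind=> y1 y2 y3 y4; mul; rewrite ?(eqP oN) row40;
move=> /row4P[_ _ e1 e2]; have x10 : x1 = 0 by nra.
all: rewrite !row4Z x10; first [rewrite H | case: H => -> ->]; apply/row4P; split; ring.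
Qed.

Local Notation sqrt2 := (Num.sqrt 2 : R).

Lemma sqr_sqrt2 : sqrt2 ^+ 2 = 2.
Proof. by rewrite sqr_sqrtr. Qed.

(** The noncommutative pencils of stage 2 without common isotropic vector outside A^2. *)
Definition pencil_name N : bool :=
  match N with A4_18 k => k == 1 | A4_24 | A4_25 _ _ _ => true | _ => false end.

(** Commutators span a line of the plane A^2, so on A^2 the functionals of [is_trace] are
    the multiples of one of them; this is its value on [d], relative to its value on [c]. *)
Definition trace_slope N : R :=
  match N with A4_24 => -1 | A4_25 _ l _ => if l == 0 then 0 else - sqrt2 | _ => 0 end.

Lemma trace_row4 N (m : {scalar (algebra_of N)}) p1 p2 p3 p4 :
  (forall x1 x2 x3 x4, m (row4 x1 x2 x3 x4) = x1 * p1 + x2 * p2 + x3 * p3 + x4 * p4) ->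
  pencil_name N -> listed N -> is_trace m <-> p4 = trace_slope N * p3.
Proof.
move=> mE pN lN; split.
  move=> /(_ ea eb); rewrite /ea /eb; move: (mE);
    case: N m mE pN lN => [ | |k|k| | | |k l|k l|k| | | | | | |k| |k|k| |k l m'] // m _
      pN lN mE; mul.
  - by rewrite !mE /trace_slope; lra.
  - by rewrite !mE /trace_slope; lra.
  - rewrite !mE /trace_slope; case: lN => /andP[k0 k1] [[-> _] | [lE _]].
      rewrite eqxx => H; have : (1 - k) * p4 = 0 by lra.
      by move/eqP; rewrite mulf_eq0 subr_eq0 gt_eqF //= => /eqP->; rewrite mul0r.
    have l0 : l != 0.
      by rewrite lE mulf_neq0 ?sqrtr_eq0 -?ltNge ?ltr0n // subr_eq0 gt_eqF.
    rewrite (negbTE l0) lE => H; have : (1 - k) * (p4 + sqrt2 * p3) = 0 by nra.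
    by move/eqP; rewrite mulf_eq0 subr_eq0 gt_eqF //= addr_eq0 => /eqP->; rewrite mulNr.
move=> p4E; coords; move: (mE) p4E;
  case: N m mE pN lN => [ | |k|k| | | |k l|k l|k| | | | | | |k| |k|k| |k l m'] // m _
    pN lN mE; mul;
rewrite !mE /trace_slope => p4E.
- rewrite p4E; ring.
- rewrite p4E; ring.
- case: lN => /andP[k0 k1] [[lE _] | [lE mE']]; move: p4E; rewrite lE;
  first by rewrite eqxx => ->; ring.
  rewrite mulf_eq0 sqrtr_eq0 leNgt ltr0n subr_eq0 gt_eqF //= => ->; rewrite mE';
    ring: sqr_sqrt2.
Qed.

Lemma trace_sign_pencil N (e : R) : e = 1 \/ e = -1 -> pencil_name N -> listed N ->
  trace_sign e (algebra_of N) <->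
  match N with
  | A4_18 _ => e = 1
  | A4_25 _ l m => e = (if l == 0 then - m else -1)
  | _ => True
  end.
Proof.
move=> e1 pN lN; split.
  move=> /(_ (functional4 0 0 1 (trace_slope N))) H; refine (_ (H _ ea eb)); clear H;
    last first.
    by apply/(trace_row4 (functional4_row4 0 0 1 _) pN lN); rewrite mulr1.
  rewrite /mixed_det /ea /eb; case: N pN lN =>
    [ | |k|k| | | |k l|k l|k| | | | | | |k| |k|k| |k l m'] // pN lN; mul;
      rewrite /= !functional4_row4 /trace_slope.
  - by rewrite (eqP pN); case: e1 => ->; lra.
  - case: lN => _ [[-> mE] | [lE mE]].
      by rewrite eqxx; case: mE => ->; case: e1 => ->; lra.
    case: ifP => [/eqP-> | _]; rewrite mE; first by case: e1 => ->; lra.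
    rewrite lE => H; have : 0 <= e * (2 * (1 - sqrt2 ^+ 2))
      by move: H; congr (0 <= _); ring.
    by rewrite sqr_sqrt2; case: e1 => ->; lra.
move=> H m tm; have [p1 [p2 [p3 [p4 mE]]]] := scalar_row4 m.
have {tm} p4E := (trace_row4 mE pN lN).1 tm.
elim/row4_ind=> x1 x2 x3 x4; elim/row4_ind=> y1 y2 y3 y4; rewrite /mixed_det.
pose D := x1 * y2 - x2 * y1.
have two : 0 <= 2 :> R by [].
have sq (k : R) : 0 <= k -> 0 <= k * (p3 * D) ^+ 2.
  by move=> k0; rewrite mulr_ge0 ?sqr_ge0.
move: p4E H; case: N m mE pN lN =>
  [ | |k|k| | | |k l|k l|k| | | | | | |k| |k|k| |k l m'] // m mE pN lN; mul;
    rewrite !mE /trace_slope => p4E H;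
  rewrite p4E.
- by rewrite H (eqP pN); have := sq 2 two; congr (0 <= _); rewrite /D; ring.
- by rewrite le_eqVlt; apply/orP; left; apply/eqP; ring.
- rewrite H; case: lN => _ [[lE mE'] | [lE mE']].
    rewrite lE eqxx; have := sq 2 two; congr (0 <= _).
    by case: mE' => ->; rewrite /D; ring.
  case: eqVneq p4E => [l0 | _] p4E.
    by have := sq 2 two; congr (0 <= _); rewrite mE' l0 /D; ring.
  by have := sq 2 two; congr (0 <= _); rewrite mE' lE /D; ring: sqr_sqrt2.
Qed.

(** The forms orthogonal to the symmetric one are proportional to the one with coefficients
    (0, 1) on ([c], [d]), unless the second parameter of [A4_25] is sqrt 2 (1 - al); then
    the coefficients are (1 + al, - sqrt 2 al). *)
Lemma pencil_ratio_eval N (k : R) : pencil_name N ->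
  (if N is A4_24 then false else true) ->
  listed N -> pencil_ratio k (algebra_of N) <->
  match N with
  | A4_25 al l _ =>
      if l == 0 then k * (1 - al) ^+ 2 = - al else 2 * k * (1 - al) ^+ 2 = 1 + al ^+ 2
  | _ => 4 * k = 1
  end.
Proof.
move=> pN nN lN; split=> [H | kE].
  (* The form with coefficients (q3, q4) on [c], [d] is orthogonal to the symmetric one. *)
  pose q3 : R := if N is A4_25 al l _ then if l == 0 then 0 else 1 + al else 0.
  pose q4 : R := if N is A4_25 al l _ then if l == 0 then 1 else - sqrt2 * al else 1.
  refine (_ (H (functional4 0 0 q3 q4) (functional4 0 0 1 (trace_slope N))
               _ _ _ ea eb I I)); clear H.
  - rewrite /mixed_det /ea /eb /q3 /q4;
    case: N pN nN lN @q3 @q4 => [ | |k'|k'| | | |k' l|k' l|k'| | | | | | |k'| |k'|k'|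
      |k' l m'] // pN _ lN q3 q4; mul;
      rewrite /= !functional4_row4; first lra.
    case: lN => /andP[k0 k1] [[-> mE'] | [lE mE']]; first by rewrite eqxx; lra.
    case: eqVneq => [l0 | l0]; first by nra.
    have t0 : 2 != 0 :> R by rewrite pnatr_eq0.
    rewrite lE mE' => H; apply: (mulfI t0).
    etransitivity; last (etransitivity; first exact: (esym H)); ring: sqr_sqrt2.
  - apply/(trace_row4 (functional4_row4 0 0 1 _) pN lN); by rewrite mulr1.
  - by exists ea, ea; rewrite /ea;
    case: N pN nN lN @q3 @q4 => [ | |k'|k'| | | |k' l|k' l|k'| | | | | | |k'| |k'|k'|
      |k' l m'] // *; mul;
      rewrite /= functional4_row4; lra.
  - coords; rewrite /mixed_det /q3 /q4;
    case: N pN nN lN @q3 @q4 => [ | |k'|k'| | | |k' l|k' l|k'| | | | | | |k'| |k'|k'|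
      |k' l m'] // pN _ lN q3 q4; mul;
      rewrite /= !functional4_row4; first by ring.
    case: lN => /andP[k0 k1] [[-> mE'] | [lE mE']]; first by rewrite eqxx; ring.
    case: eqVneq => [l0 | l0]; first by rewrite l0; ring.
    by rewrite lE mE'; ring: sqr_sqrt2.
move=> f g tg [x [y gxy]] fg.
have [m1 [m2 [m3 [m4 gE]]]] := scalar_row4 g;
  have [q1 [q2 [q3 [q4 fE]]]] := scalar_row4 f.
have {tg} m4E := (trace_row4 gE pN lN).1 tg.
have m30 : m3 != 0.
  apply/eqP => m30; apply: gxy; rewrite m30 mulr0 in m4E.
  elim/row4_ind: x {fg} => x1 x2 x3 x4; elim/row4_ind: y => y1 y2 y3 y4.
  move: gE; case: N pN nN lN g m4E kE f fE =>
    [ | |k'|k'| | | |k' l|k' l|k'| | | | | | |k'| |k'|k'| |k' l m'] // _ _ _ g m4E _ f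
      fE gE; mul;
  by rewrite gE m30 m4E; ring.
have {fg gxy x y} : mixed_det f g ea eb = 0 by exact: fg.
move=> fg; elim/row4_ind=> x1 x2 x3 x4; elim/row4_ind=> y1 y2 y3 y4 _ _.
pose D := x1 * y2 - x2 * y1.
move: fg m4E kE; rewrite /mixed_det /ea /eb /trace_slope; move: gE.
case: N pN nN lN g f fE => [ | |k'|k'| | | |k' l|k' l|k'| | | | | | |k'| |k'|k'| |k' l
  m'] // pN _ lN g f fE gE; mul;
  rewrite !gE !fE => fg m4E kE; rewrite m4E in fg.
- rewrite (eqP pN) in fg *.
  have -> : q3 = 0.
    have /eqP : m3 * q3 = 0 by lra.
    by rewrite mulf_eq0 (negbTE m30) => /eqP.
  transitivity (2 * 1 * (q4 * D) ^+ 2); first by rewrite /D; ring.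
  by rewrite -kE /D; ring.
case: lN => /andP[k0 k1] [[lE mE'] | [lE mE']].
  move: fg kE; rewrite lE eqxx => fg kE.
  have -> : q3 = 0.
    have /eqP : m3 * q3 = 0 by case: mE' => mE'; rewrite mE' in fg; lra.
    by rewrite mulf_eq0 (negbTE m30) => /eqP.
  transitivity (2 * (- k') * (q4 * D) ^+ 2); first by rewrite /D; ring.
  by rewrite -kE /D; ring.
have l0 : l != 0.
  by rewrite lE mulf_neq0 ?sqrtr_eq0 -?ltNge ?ltr0n // subr_eq0 gt_eqF.
move: fg kE; rewrite (negbTE l0) lE mE' => fg kE.
have al : 1 + k' != 0 by rewrite gt_eqF //; lra.
have q4E : q4 = - sqrt2 * k' * (q3 / (1 + k')).
  apply: (mulfI al); have -> : (1 + k') * (- sqrt2 * k' * (q3 / (1 + k'))) = - sqrt2 * k' * q3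
    by field.
  apply/eqP; rewrite -subr_eq0; apply/eqP; apply: (mulfI m30); rewrite mulr0.
  have t0 : sqrt2 != 0 by rewrite sqrtr_eq0 -ltNge ltr0n.
  apply: (mulfI t0); rewrite mulr0 -[RHS]fg; ring: sqr_sqrt2.
have q3E : q3 = (1 + k') * (q3 / (1 + k')) by rewrite mulrC divfK.
move: (q3 / (1 + k')) q4E q3E => r -> ->.
transitivity (2 * (1 + k' ^+ 2) * (r * D) ^+ 2); first by rewrite /D; ring: sqr_sqrt2.
rewrite -kE /D; ring: sqr_sqrt2.
Qed.

End Evaluation.

(** * Listed algebras are pairwise nonisomorphic *)

Section Uniqueness.
Variable R : realType.
Implicit Types (N : name R) (A B : algebra R).

Lemma same_value (P : algebra R -> Prop) A B (p q : bool) :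
  (forall A B, isomorphic A B -> P A -> P B) -> isomorphic A B ->
  (P A <-> p) -> (P B <-> q) -> p = q.
Proof.
move=> inv AB Pp Pq; apply/idP/idP => [/Pp PA | /Pq PB].
  by apply/Pq; exact: inv AB PA.
by apply/Pp; exact: inv (isomorphic_sym AB) PB.
Qed.

(** The ratio - x / (1 - x)^2 is injective in x because the equality of two ratios factors
    as (x - y)(1 - xy) = 0. *)
Lemma ratio_inj (x y k : R) : -1 < x < 1 -> -1 < y < 1 ->
  k * (1 - x) ^+ 2 = - x -> k * (1 - y) ^+ 2 = - y -> x = y.
Proof.
move=> /andP[x1 x2] /andP[y1 y2] kx ky.
have /eqP : (x - y) * (1 - x * y) = 0.
  transitivity (k * (1 - y) ^+ 2 * (1 - x) ^+ 2 - k * (1 - x) ^+ 2 * (1 - y) ^+ 2).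
    by rewrite kx ky; ring.
  by ring.
by rewrite mulf_eq0 => /orP[] /eqP xy; [lra | exfalso; nra].
Qed.

(** The same factorisation holds for the ratio (1 + x^2) / (2 (1 - x)^2). *)
Lemma ratio_inj_sqrt2 (x y k : R) : -1 < x < 1 -> -1 < y < 1 ->
  2 * k * (1 - x) ^+ 2 = 1 + x ^+ 2 -> 2 * k * (1 - y) ^+ 2 = 1 + y ^+ 2 -> x = y.
Proof.
move=> /andP[x1 x2] /andP[y1 y2] kx ky.
have /eqP : (x - y) * (1 - x * y) = 0.
  transitivity ((2 * k * (1 - x) ^+ 2 * (1 - y) ^+ 2
                 - 2 * k * (1 - y) ^+ 2 * (1 - x) ^+ 2) / 2).
    by rewrite kx ky; field.
  by field.
by rewrite mulf_eq0 => /orP[] /eqP xy; [lra | exfalso; nra].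
Qed.

(** The first ratio is 1/4 - ((1 + x) / (1 - x))^2 / 4 and the second one is
    1/4 + ((1 + y) / (1 - y))^2 / 4. *)
Lemma ratio_disjoint (x y k : R) : -1 < y -> x < 1 ->
  k * (1 - x) ^+ 2 = - x -> 2 * k * (1 - y) ^+ 2 = 1 + y ^+ 2 -> False.
Proof.
move=> y1 x1 kx ky.
have x0 : 0 < (1 - x) ^+ 2 by rewrite exprn_gt0 // subr_gt0.
have : (4 * k - 1) * (1 - x) ^+ 2 <= 0.
  have -> : (4 * k - 1) * (1 - x) ^+ 2 = 4 * (k * (1 - x) ^+ 2) - (1 - x) ^+ 2 by ring.
  by rewrite kx; have := sqr_ge0 (1 + x); lra.
rewrite pmulr_lle0 // => k0.
have : 0 < (4 * k - 1) * (1 - y) ^+ 2.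
  have -> : (4 * k - 1) * (1 - y) ^+ 2 =
    2 * (2 * k * (1 - y) ^+ 2) - (1 - y) ^+ 2 by ring.
  rewrite ky; have : 0 < (1 + y) ^+ 2 by rewrite exprn_gt0 //; lra.
  lra.
by rewrite ltNge mulr_le0_ge0 ?sqr_ge0.
Qed.

Lemma ratio_quarter (x k : R) : -1 < x -> 4 * k = 1 -> k * (1 - x) ^+ 2 = - x -> False.
Proof.
move=> x1 k4 kx; have : 0 < (1 + x) ^+ 2 by rewrite exprn_gt0 //; lra.
have := congr1 ( *%R 4) kx; rewrite mulrA k4; lra.
Qed.

Lemma opp1_neq1 : -1 <> 1 :> R.
Proof. by lra. Qed.

Section Pair.
Variables N N' : name R.
Hypotheses (lN : listed N) (lN' : listed N').
Hypothesis NN' : isomorphic (algebra_of N) (algebra_of N').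

Lemma same_stage : stage N = stage N'.
Proof.
have e3 : (stage N < 3)%N = (stage N' < 3)%N.
  exact: (same_value (@iso_cube_zero R) NN' (cube_zero_stage N) (cube_zero_stage N')).
have e0 : (stage N == 0) = (stage N' == 0).
  by apply: (same_value (@iso_zero_mul R) NN'); rewrite zero_mul_stage; split=> /eqP.
have e2 : (stage N < 3)%N -> (stage N < 2)%N = (stage N' < 2)%N.
  move=> s3; have s3' := s3; rewrite e3 in s3'.
  exact: (same_value (@iso_products_on_line R) NN' (products_on_line_stage s3)
    (products_on_line_stage s3')).
have le3 (M : name R) : (stage M < 4)%N by case: M.
move: e3 e0 e2 (le3 N) (le3 N').
by case: (stage N) => [|[|[|[|]]]] //; case: (stage N') => [|[|[|[|]]]] // _ _ /(_ isT).
Qed.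

Lemma unique_stage3 : stage N = 3 -> N = N'.
Proof.
move=> s3; have s3' := s3; rewrite same_stage in s3'.
have := same_value (@iso_commutes R) NN' (commutes_stage3 s3) (commutes_stage3 s3').
have := same_value (@iso_fourth_zero R) NN' (fourth_zero_stage3 s3)
  (fourth_zero_stage3 s3').
have := same_value (@iso_ann_sq_null R) NN' (ann_sq_null_stage3 s3)
  (ann_sq_null_stage3 s3').
by case: N s3 => // _; case: N' s3'.
Qed.

(** Commutative forms are told apart by rank and definiteness, the others by the position of
    the central vectors; the parameters of [A4_4] and [A4_9] come from [form_ratio]. *)
Lemma unique_stage1 : stage N = 1 -> N = N'.
Proof.
move=> s1; have s1' := s1; rewrite same_stage in s1'.
have s12 : (0 < stage N < 3)%N by rewrite s1.
have s12' : (0 < stage N' < 3)%N by rewrite s1'.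
have comm := same_value (@iso_commutes R) NN' (commutes_stage12 s12 lN)
  (commutes_stage12 s12' lN').
have [cN | cN] := boolP (comm_stage1 N).
  have cN' : comm_stage1 N'.
    by move: cN s1' comm; case: (N) => //=; case: (N').
  have := same_value (@iso_semidefinite R) NN' (semidefinite_comm cN lN)
    (semidefinite_comm cN' lN').
  have := same_value (@iso_orthogonal_pair R) NN' (orthogonal_pair_comm cN lN)
    (orthogonal_pair_comm cN' lN').
  have := same_value (@iso_orthogonal_triple R) NN' (orthogonal_triple_comm cN lN)
    (orthogonal_triple_comm cN' lN').
  have m1 : (-1 == 1 :> R) = false by apply/eqP; lra.
  case: N cN lN => [ | |k|k| | | |k l|k l|k| | | | | | |k| |k|k| |k l m] // _ l1;
    case: N' cN' lN' => [ | |k'|k'| | | |k' l'|k' l'|k'| | | | | | |k'| |k'|k'| |k' l'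
      m'] // _ l2 _ _.
    by case: l1 => ->; case: l2 => ->; rewrite ?eqxx ?m1.
  by case: l1 => -> [->|->]; case: l2 => -> [->|->]; rewrite ?eqxx ?m1.
have nN : noncomm_stage1 N by move: cN s1; case: N.
have nN' : noncomm_stage1 N'.
  by move: s1' comm nN; case: (N') => //=; case: (N).
have := same_value (@iso_central_ann R) NN' (central_ann_noncomm nN lN)
  (central_ann_noncomm nN' lN').
have := same_value (@iso_central_sq R) NN' (central_sq_noncomm nN lN)
  (central_sq_noncomm nN' lN').
have := same_value (@iso_center_orthogonal_sq_null R) NN'
  (center_orthogonal_sq_null_noncomm nN lN) (center_orthogonal_sq_null_noncomm nN' lN').
case: N nN lN NN' => [ | |k|k| | | |k l|k l|k| | | | | | |k| |k|k| |k l m] // _ l1 iso;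
  case: N' nN' lN' iso => [ | |k'|k'| | | |k' l'|k' l'|k'| | | | | | |k'| |k'|k'| |k'
    l' m'] // _ l2 iso _ _ _.
- congr A4_4; apply/form_ratio_A4_4.
  by apply: (iso_form_ratio iso); apply/form_ratio_A4_4.
- have kk : l = l'.
    by apply/(form_ratio_A4_9 _ l2)/(iso_form_ratio iso)/(form_ratio_A4_9 _ l1).
  subst l'; move: iso.
  case: l1 (l1) => [-> | [-> k4]] l1; case: l2 (l2) => [-> | [-> k4']] l2 // iso.
    have [//] : -1 = 1 :> R; last by move=> ->.
    by apply/(semidefinite_A4_9 l2 k4')/(iso_semidefinite iso)/(semidefinite_A4_9 l1 k4').
  have [//] : -1 = 1 :> R; last by move=> ->.
  by apply/(semidefinite_A4_9 l1 k4)/(iso_semidefinite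
    (isomorphic_sym iso))/(semidefinite_A4_9 l2 k4).
- by case: l1 => ->; case: l2 => ->.
Qed.

(** With a common isotropic vector, the ratio of xy to yx for xx = 0 decides. Without one,
    the commutative pencils differ by their zero divisors, and the others by the sign of the
    determinant of their symmetric form and by [pencil_ratio]. *)
Lemma unique_stage2 : stage N = 2 -> N = N'.
Proof.
move=> s2; have s2' := s2; rewrite same_stage in s2'.
have s12 : (0 < stage N < 3)%N by rewrite s2.
have s12' : (0 < stage N' < 3)%N by rewrite s2'.
have comm := same_value (@iso_commutes R) NN' (commutes_stage12 s12 lN)
  (commutes_stage12 s12' lN').
have null := same_value (@iso_sq_null R) NN' (sq_null_stage2 s2 lN)
  (sq_null_stage2 s2' lN').
have [nN | nN] := boolP (sq_null_name N).
  have nN' : sq_null_name N' by rewrite -null.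
  have orth := same_value (@iso_sq_null_orth R) NN'
    (sq_null_orth_stage2 s2 lN nN) (sq_null_orth_stage2 s2' lN' nN').
  have [oN | noN] := boolP (if N is A4_18 k then k == 0 else true); last first.
    have noN' := noN; rewrite orth in noN'.
    have only (M : name R) : listed M -> sq_null_name M ->
        ~~ (if M is A4_18 k then k == 0 else true) -> M = A4_18 (-1).
      by case: M => [ | |k|k| | | |k l|k l|k| | | | | | |k| |k|k| |k l m] //
        [->|->|->]; rewrite /sq_null_name ?eqxx.
    by rewrite (only N lN nN noN) (only N' lN' nN' noN').
  have oN' := oN; rewrite orth in oN'.
  have ratio s t : ratio_condition N s t <-> ratio_condition N' s t.
    rewrite -(sq_null_ratio_stage2 s t oN s2 lN nN) -(sq_null_ratio_stage2 s t oN' s2'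
      lN' nN').
    by split; apply: iso_sq_null_ratio => //; exact: isomorphic_sym.
  have := ratio 1; move: (ratio 0 1) (ratio 1 (-1)).
  case: N s2 lN nN oN => [ | |k|k| | | |k l|k l|k| | | | | | |k| |k|k| |k l m] // _ l1
    n1 o1; case: N' s2' lN' nN' oN' =>
      [ | |k'|k'| | | |k' l'|k' l'|k'| | | | | | |k'| |k'|k'| |k' l' m'] // _ l2 n2 o2;
    rewrite /ratio_condition => -[t1 t2] [t3 t4] t5.
  - by move: (t1 erefl) => {t1 t2 t3 t4 t5} ?; exfalso; lra.
  - by case: (t1 erefl) => {t1 t2 t3 t4 t5} _ ?; exfalso; lra.
  - by move: (t1 erefl) => {t1 t2 t3 t4 t5} ?; exfalso; lra.
  - by move: (t2 erefl) => {t1 t2 t3 t4 t5} ?; exfalso; lra.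
  - by rewrite (eqP o1) (eqP o2).
  - by case: (t3 erefl) => {t1 t2 t3 t4 t5} ? _; exfalso; lra.
  - by exfalso; apply: l2; move: (t3 erefl) => {t1 t2 t3 t4 t5} ?; lra.
  - by case: (t2 erefl) => {t1 t2 t3 t4 t5} _ ?; exfalso; lra.
  - by case: (t4 erefl) => {t1 t2 t3 t4 t5} ? _; exfalso; lra.
  - by case: ((t5 _).2 (esym (mul1r _))) => {t1 t2 t3 t4 t5} ? _; exfalso; lra.
  - by move: (t2 erefl) => {t1 t2 t3 t4 t5} ?; exfalso; lra.
  - by exfalso; apply: l1; move: (t4 erefl) => {t1 t2 t3 t4 t5} ?; lra.
  - by case: ((t5 _).1 (esym (mul1r _))) => {t1 t2 t3 t4 t5} ? _; exfalso; lra.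
  - by rewrite ((t5 _).1 (esym (mul1r _))) mul1r.
have nN' : ~~ sq_null_name N' by rewrite -null.
have [cN | cN] := boolP (commutative_name N).
  have cN' : commutative_name N' by rewrite -comm.
  move: NN'; case: N s2 lN nN cN =>
    [ | |k|k| | | |k l|k l|k| | | | | | |k| |k|k| |k l m] // _ l1 n1 c1;
      case: N' s2' lN' nN' cN' => [ | |k'|k'| | | |k' l'|k' l'|k'| | | | | | |k'|
        |k'|k'| |k' l' m'] // _ l2 n2 c2 iso.
  have m1 : -1 <> 1 :> R by lra.
  have k1 := zero_divisors_A4_23 l1; have k2 := zero_divisors_A4_23 l2.
  case: l1 iso k1 => -> iso k1; case: l2 iso k2 => -> iso k2 //; exfalso; apply: m1.
    by apply/esym/k1/(iso_zero_divisors (isomorphic_sym iso))/k2.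
  by apply/esym/k2/(iso_zero_divisors iso)/k1.
have pencil (M : name R) : stage M = 2 -> listed M -> ~~ sq_null_name M ->
    ~~ commutative_name M -> pencil_name M.
  by case: M => [ | |k|k| | | |k l|k l|k| | | | | | |k| |k|k| |k l m] // _ _;
    rewrite /sq_null_name /pencil_name ?negbK.
have pN := pencil N s2 lN nN cN.
have cN' : ~~ commutative_name N' by rewrite -comm.
have pN' := pencil N' s2' lN' nN' cN'.
have sg e : trace_sign e (algebra_of N) <-> trace_sign e (algebra_of N').
  by split; apply: iso_trace_sign => //; exact: isomorphic_sym.
have o1 : (1 : R) = 1 \/ (1 : R) = -1 by left.
have o2 : (-1 : R) = 1 \/ (-1 : R) = -1 by right.
move: (sg 1) (sg (-1)).
rewrite (trace_sign_pencil o1 pN lN) (trace_sign_pencil o2 pN lN).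
rewrite (trace_sign_pencil o1 pN' lN') (trace_sign_pencil o2 pN' lN').
have [r kN] : exists r, (if N is A4_24 then false else true) ->
    pencil_ratio r (algebra_of N).
  case: (N) pN lN => [ | |k|k| | | |k l|k l|k| | | | | | |k| |k|k| |k l m] // p1 l1;
    try by exists 0.
    by exists 4^-1 => n24; apply/(pencil_ratio_eval _ p1 n24 l1);
      rewrite divff ?pnatr_eq0.
  have [/andP[_ k1] _] := l1.
  have k0 : 1 - k != 0 by rewrite subr_eq0 gt_eqF.
  exists (if l == 0 then - k / (1 - k) ^+ 2 else (1 + k ^+ 2) / 2 / (1 - k) ^+ 2) => n24.
  apply/(pencil_ratio_eval _ p1 n24 l1); by case: (l == 0); field.
have kN' : (if N is A4_24 then false else true) -> pencil_ratio r (algebra_of N').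
  by move=> /kN; exact: iso_pencil_ratio.
have m1 := opp1_neq1.
have slope_case (x y z : R) : listed (A4_25 x y z) ->
    y = 0 /\ (z = 1 \/ z = -1) \/ [/\ y != 0, y = Num.sqrt 2 * (1 - x) & z = -1].
  case=> /andP[_ x1] [|[yE zE]]; [by left | right; split=> //].
  by rewrite yE mulf_neq0 ?sqrtr_eq0 -?ltNge ?ltr0n // subr_eq0 gt_eqF.
move: kN kN'; case: (N) pN lN => [ | |k|k| | | |k l|k l|k| | | | | | |k| |k|k| |k l m]
  // p1 l1; case: (N') pN' lN' => [ | |k'|k'| | | |k' l'|k' l'|k'| | | | | | |k'|
    |k'|k'| |k' l' m'] // p2 l2 kN kN' t1 t2.
- by rewrite (eqP p1) (eqP p2).
- by case: m1; exact: t2.2 I.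
- have k1 := (pencil_ratio_eval _ p1 isT l1).1 (kN isT).
  have := (pencil_ratio_eval _ p2 isT l2).1 (kN' isT).
  have := t1.1 erefl; case: (slope_case _ _ _ l2) => [[-> _] | [l0 _ _]].
    rewrite eqxx => _ k2; have [/andP[k'1 _] _] := l2.
    by case: (ratio_quarter k'1 k1 k2).
  by rewrite (negbTE l0) => /esym/m1.
- by case: m1; exact: t2.1 I.
- by case: m1; rewrite {1}(t2.1 I) -(t1.1 I).
- have k2 := (pencil_ratio_eval _ p2 isT l2).1 (kN' isT).
  have := (pencil_ratio_eval _ p1 isT l1).1 (kN isT).
  have := t1.2 erefl; case: (slope_case _ _ _ l1) => [[-> _] | [l0 _ _]].
    rewrite eqxx => _ k1; have [/andP[k'1 _] _] := l1.
    by case: (ratio_quarter k'1 k2 k1).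
  by rewrite (negbTE l0) => /esym/m1.
- by case: m1; rewrite {1}(t2.2 I) -(t1.2 I).
have := (pencil_ratio_eval _ p1 isT l1).1 (kN isT).
have := (pencil_ratio_eval _ p2 isT l2).1 (kN' isT).
have [b1 _] := l1; have [b2 _] := l2.
have /andP[b11 b12] := b1; have /andP[b21 b22] := b2.
move: t1 t2; case: (slope_case _ _ _ l1) => [[-> zE] | [y0 yE ->]];
  case: (slope_case _ _ _ l2) => [[-> zE'] | [y0' yE' ->]];
  rewrite ?eqxx ?(negbTE y0) ?(negbTE y0') => t1 t2 k2 k1.
- rewrite (ratio_inj b1 b2 k1 k2); congr A4_25; move: t1.
  case: zE => ->; case: zE' => -> // [t11 t12].
    by case: m1; rewrite -[in LHS](t12 _) ?opprK.
  by case: m1; rewrite -[in LHS](t11 _) ?opprK.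
- by case: (ratio_disjoint b21 b12 k1 k2).
- by case: (ratio_disjoint b11 b22 k2 k1).
- by rewrite yE yE' (ratio_inj_sqrt2 b1 b2 k1 k2).
Qed.

Lemma listed_unique : N = N'.
Proof.
case sN : (stage N) => [|[|[|n]]].
- have := sN; rewrite same_stage; case: (N) sN => // _; by case: (N').
- exact: unique_stage1.
- exact: unique_stage2.
by apply: unique_stage3; move: sN; case: (N) => //= ? ; case.
Qed.

End Pair.
End Uniqueness.

Theorem proposition7p8 (R : realType) :
  (forall N : name R, listed N ->
     nilpotent_assoc_algebra_of_dim 4 (algebra_of N)) /\
  (forall A : algebra R, nilpotent_assoc_algebra_of_dim 4 A ->
     exists! N : name R, listed N /\ isomorphic A (algebra_of N)).
Proof.
split=> [N _ | A [dimA assocA nilA]]; first exact: algebra_of_nilpotent_assoc.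
have [N lN AN] := classified_nilpotent dimA assocA nilA.
exists N; split=> // N' [lN' AN']; apply: listed_unique => //.
exact: isomorphic_trans (isomorphic_sym AN) AN'.
Qed.
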